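(* Let $t\in\mathbb T$, $x\in l^2_{\mathcal F}(t;\mathbb R^n)$. The following are equivalent: (i) Problem (LQ)$_{tx}$ admits a mixed equilibrium solution; (ii) there is a pair $(\Phi,v)$, $\Phi=(\Phi_k)_{k\in\mathbb T_t}$ deterministic in $\mathbb R^{m\times n}$, $v\in l^2_{\mathcal F}(\mathbb T_t;\mathbb R^m)$, such that for every $k\in\mathbb T_t$ the stationarity condition $$0=\mathcal R_{k,k}(\Phi_kX^{k,\Phi}_k+v_k)+\mathcal B_{k,k}^T\mathbb E_kY^{k,\Phi}_{k+1}+\sum_{i=1}^p(\mathcal D^i_{k,k})^T\mathbb E_k(Y^{k,\Phi}_{k+1}w^i_k)+\rho_{k,k}\quad\text{a.s.}$$ holds and the convexity condition $\widetilde J(k,0;\bar u_k)\ge0$ a.s. holds for all $\bar u_k\in l^2_{\mathcal F}(k;\mathbb R^m)$. Moreover, under these conditions, the pair $(\Phi,v)$ of (ii) is a mixed equilibrium solution of Problem (LQ)$_{tx}$.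
   Context: Standing setup. Fix integers $N,n,m,p\ge1$; $\mathbb T=\{0,1,\dots,N-1\}$ and for $t\in\mathbb T$, $\mathbb T_t=\{t,\dots,N-1\}$. On a probability space $(\Omega,\mathcal F,P)$ let $w_k=(w^1_k,\dots,w^p_k)^T$, $k\in\mathbb T$, be square-integrable random vectors; $\mathcal F_0=\{\emptyset,\Omega\}$, $\mathcal F_k=\sigma\{w_0,\dots,w_{k-1}\}$, $\mathbb E_k[\cdot]=\mathbb E[\cdot\mid\mathcal F_k]$; assume $\mathbb E_k[w_k]=0$ and $\mathbb E_k[w_kw_k^T]=\Delta_k=(\delta^{ij}_k)_{p\times p}$ is deterministic. $l^2_{\mathcal F}(k;\mathbb R^r)$ is the set of $\mathcal F_k$-measurable square-integrable $\mathbb R^r$-valued random vectors, and $l^2_{\mathcal F}(\mathbb T_t;\mathbb R^m)$ the set of sequences $(u_k)_{k\in\mathbb T_t}$ with $u_k\in l^2_{\mathcal F}(k;\mathbb R^m)$. For all $t\in\mathbb T$, $k\in\mathbb T_t$, $i=1,\dots,p$ there are given deterministic data $A_{t,k},\bar A_{t,k},C^i_{t,k},\bar C^i_{t,k}\in\mathbb R^{n\times n}$, $B_{t,k},\bar B_{t,k},D^i_{t,k},\bar D^i_{t,k}\in\mathbb R^{n\times m}$, $f_{t,k},d^i_{t,k}\in\mathbb R^n$, symmetric $Q_{t,k},\bar Q_{t,k}\in\mathbb R^{n\times n}$, symmetric $R_{t,k},\bar R_{t,k}\in\mathbb R^{m\times m}$, symmetric $G_t,\bar G_t\in\mathbb R^{n\times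 n}$, $F_t\in\mathbb R^{n\times n}$, $q_{t,k},g_t\in\mathbb R^n$, $\rho_{t,k}\in\mathbb R^m$. Write $\mathcal A_{t,k}=A_{t,k}+\bar A_{t,k}$, $\mathcal B_{t,k}=B_{t,k}+\bar B_{t,k}$, $\mathcal C^i_{t,k}=C^i_{t,k}+\bar C^i_{t,k}$, $\mathcal D^i_{t,k}=D^i_{t,k}+\bar D^i_{t,k}$, $\mathcal Q_{t,k}=Q_{t,k}+\bar Q_{t,k}$, $\mathcal R_{t,k}=R_{t,k}+\bar R_{t,k}$, $\mathcal G_t=G_t+\bar G_t$. $M^\dagger$ denotes the Moore–Penrose inverse, $\mathrm{Ran}$ the range, $\succeq0$ ($\succ0$) positive semidefinite (definite). For $s\in\mathbb T$, $\xi\in l^2_{\mathcal F}(s;\mathbb R^n)$ and $u=(u_k)_{k\in\mathbb T_s}$ (adapted, square integrable), the state starting from the initial pair $(s,\xi)$ is $X_s=\xi$, $X_{k+1}=A_{s,k}X_k+\bar A_{s,k}\mathbb E_sX_k+B_{s,k}u_k+\bar B_{s,k}\mathbb E_su_k+f_{s,k}+\sum_{i=1}^p\big(C^i_{s,k}X_k+\bar C^i_{s,k}\mathbb E_sX_k+D^i_{s,k}u_k+\bar D^i_{s,k}\mathbb E_su_k+d^i_{s,k}\big)w^i_k$, $k\in\mathbb T_s$ (a control may also be given in feedback form $u_k=\Phi_kX_k+v_k$, in which case the recursion is solved with this $u_k$), and the cost is the $\mathcal F_s$-measurable random variable $J(s,\xi;u)=\sum_{k=s}^{N-1}\mathbb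 E_s\big[X_k^TQ_{s,k}X_k+(\mathbb E_sX_k)^T\bar Q_{s,k}\mathbb E_sX_k+u_k^TR_{s,k}u_k+(\mathbb E_su_k)^T\bar R_{s,k}\mathbb E_su_k+2q_{s,k}^TX_k+2\rho_{s,k}^Tu_k\big]+\mathbb E_s[X_N^TG_sX_N]+(\mathbb E_sX_N)^T\bar G_s\mathbb E_sX_N+2(F_s\xi+g_s)^T\mathbb E_sX_N$. Problem (LQ)$_{tx}$ is this problem with initial pair $(t,x)$. (In)equalities between random variables are understood almost surely. Mixed equilibrium solution. Let $t\in\mathbb T$, $x\in l^2_{\mathcal F}(t;\mathbb R^n)$, $\Phi=(\Phi_k)_{k\in\mathbb T_t}$ deterministic matrices in $\mathbb R^{m\times n}$ and $v=(v_k)_{k\in\mathbb T_t}\in l^2_{\mathcal F}(\mathbb T_t;\mathbb R^m)$. The equilibrium state $X^*=X^{t,x,*}$ is $X^*_t=x$, $X^*_{k+1}=(\mathcal A_{k,k}+\mathcal B_{k,k}\Phi_k)X^*_k+\mathcal B_{k,k}v_k+f_{k,k}+\sum_{i=1}^p\big[(\mathcal C^i_{k,k}+\mathcal D^i_{k,k}\Phi_k)X^*_k+\mathcal D^i_{k,k}v_k+d^i_{k,k}\big]w^i_k$, $k\in\mathbb T_t$. For $k\in\mathbb T_t$, $X^{k,\Phi}$ is the state from the initial pair $(k,X^*_k)$ under the feedback control $u_\ell=\Phi_\ell X_\ell+v_\ell$, $\ell\in\mathbb T_k$; for $u_k\in l^2_{\mathcal F}(k;\mathbb R^m)$, $X^{k,u_k,\Phi}$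 is the state from $(k,X^*_k)$ under $u_k$ at time $k$ and $u_\ell=\Phi_\ell X_\ell+v_\ell$ for $\ell\in\mathbb T_{k+1}$. The pair $(\Phi,v)$ (pure-feedback-strategy part $\Phi$, independent of $x$; open-loop-control part $v$, which may depend on $x$) is a mixed equilibrium solution of Problem (LQ)$_{tx}$ if for every $k\in\mathbb T_t$ and $u_k\in l^2_{\mathcal F}(k;\mathbb R^m)$: $J\big(k,X^*_k;(\Phi_\ell X^{k,\Phi}_\ell+v_\ell)_{\ell\in\mathbb T_k}\big)\le J\big(k,X^*_k;(u_k,(\Phi_\ell X^{k,u_k,\Phi}_\ell+v_\ell)_{\ell\in\mathbb T_{k+1}})\big)$ a.s. The process $Y^{k,\Phi}$ is defined backward by $Y^{k,\Phi}_N=G_kX^{k,\Phi}_N+\bar G_k\mathbb E_kX^{k,\Phi}_N+F_kX^*_k+g_k$ and, for $\ell\in\mathbb T_k$, $Y^{k,\Phi}_\ell=(Q_{k,\ell}+\Phi_\ell^TR_{k,\ell}\Phi_\ell)X^{k,\Phi}_\ell+(\bar Q_{k,\ell}+\Phi_\ell^T\bar R_{k,\ell}\Phi_\ell)\mathbb E_kX^{k,\Phi}_\ell+\Phi_\ell^TR_{k,\ell}v_\ell+\Phi_\ell^T\bar R_{k,\ell}\mathbb E_kv_\ell+(A_{k,\ell}+B_{k,\ell}\Phi_\ell)^T\mathbb E_\ell Y^{k,\Phi}_{\ell+1}+(\bar A_{k,\ell}+\bar B_{k,\ell}\Phi_\ell)^T\mathbb E_kY^{k,\Phi}_{\ell+1}+\sum_{i=1}^p\big[(C^i_{k,\ell}+D^i_{k,\ell}\Phi_\ell)^T\mathbb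 E_\ell(Y^{k,\Phi}_{\ell+1}w^i_\ell)+(\bar C^i_{k,\ell}+\bar D^i_{k,\ell}\Phi_\ell)^T\mathbb E_k(Y^{k,\Phi}_{\ell+1}w^i_\ell)\big]+\Phi_\ell^T\rho_{k,\ell}+q_{k,\ell}$. For $\bar u_k\in l^2_{\mathcal F}(k;\mathbb R^m)$, the process $\alpha=\alpha^{k,\bar u_k}$ is: $\alpha_k=0$, $\alpha_{k+1}=\mathcal B_{k,k}\bar u_k+\sum_{i}\mathcal D^i_{k,k}\bar u_kw^i_k$, and for $\ell\in\mathbb T_{k+1}$: $\alpha_{\ell+1}=(A_{k,\ell}+B_{k,\ell}\Phi_\ell)\alpha_\ell+(\bar A_{k,\ell}+\bar B_{k,\ell}\Phi_\ell)\mathbb E_k\alpha_\ell+\sum_i\big[(C^i_{k,\ell}+D^i_{k,\ell}\Phi_\ell)\alpha_\ell+(\bar C^i_{k,\ell}+\bar D^i_{k,\ell}\Phi_\ell)\mathbb E_k\alpha_\ell\big]w^i_\ell$, and $\widetilde J(k,0;\bar u_k)=\sum_{\ell=k}^{N-1}\mathbb E_k\big[\alpha_\ell^T(Q_{k,\ell}+\Phi_\ell^TR_{k,\ell}\Phi_\ell)\alpha_\ell+(\mathbb E_k\alpha_\ell)^T(\bar Q_{k,\ell}+\Phi_\ell^T\bar R_{k,\ell}\Phi_\ell)\mathbb E_k\alpha_\ell\big]+\mathbb E_k[\bar u_k^T\mathcal R_{k,k}\bar u_k]+\mathbb E_k[\alpha_N^TG_k\alpha_N]+(\mathbb E_k\alpha_N)^T\bar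 G_k\mathbb E_k\alpha_N$. *)

(* Defs.v *)
From HB Require Import structures.
From mathcomp Require Import all_boot all_order all_algebra.
From mathcomp Require Import all_classical all_reals all_analysis.

Set Implicit Arguments.
Unset Strict Implicit.
Unset Printing Implicit Defensive.

Import Order.TTheory GRing.Theory Num.Theory.
Local Open Scope classical_set_scope.
Local Open Scope ring_scope.

(* Deterministic data of the time-inconsistent MF-LQ problem.  Every
   coefficient is indexed by (t, k) (initial time, current time); the
   noise index i ranges over 'I_p.  Values outside t <= k < N are irrelevant. *)
Record LQdata (R : realType) (n m p : nat) := LQData {
  A_  : nat -> nat -> 'M[R]_n;       Ab_ : nat -> nat -> 'M[R]_n;
  B_  : nat -> nat -> 'M[R]_(n, m);  Bb_ : nat -> nat -> 'M[R]_(n, m);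
  C_  : nat -> nat -> 'I_p -> 'M[R]_n;      Cb_ : nat -> nat -> 'I_p -> 'M[R]_n;
  D_  : nat -> nat -> 'I_p -> 'M[R]_(n, m); Db_ : nat -> nat -> 'I_p -> 'M[R]_(n, m);
  f_  : nat -> nat -> 'cV[R]_n;      d_  : nat -> nat -> 'I_p -> 'cV[R]_n;
  Q_  : nat -> nat -> 'M[R]_n;       Qb_ : nat -> nat -> 'M[R]_n;
  R_  : nat -> nat -> 'M[R]_m;       Rb_ : nat -> nat -> 'M[R]_m;
  G_  : nat -> 'M[R]_n;              Gb_ : nat -> 'M[R]_n;
  F_  : nat -> 'M[R]_n;
  q_  : nat -> nat -> 'cV[R]_n;      g_  : nat -> 'cV[R]_n;
  rho_ : nat -> nat -> 'cV[R]_m }.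

Definition LQsym (R : realType) n m p (N : nat) (L : LQdata R n m p) : Prop :=
  (forall t k, (t <= k < N)%N ->
     (Q_ L t k)^T = Q_ L t k /\ (Qb_ L t k)^T = Qb_ L t k /\
     (R_ L t k)^T = R_ L t k /\ (Rb_ L t k)^T = Rb_ L t k) /\
  (forall t, (t < N)%N -> (G_ L t)^T = G_ L t /\ (Gb_ L t)^T = Gb_ L t).

Definition qf (R : realType) r (x : 'cV[R]_r) (M : 'M[R]_r) : R :=
  (x^T *m M *m x) ord0 ord0.
Definition dotv (R : realType) r (a b : 'cV[R]_r) : R := (a^T *m b) ord0 ord0.

Section LQ.
Context (R : realType) (dsp : measure_display) (Omega : measurableType dsp)
        (P : probability Omega R).
Context (n m p N : nat).
Context (w : nat -> 'I_p -> Omega -> R).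

(* F_k = sigma{w_0, ..., w_{k-1}} (so F_0 = {emptyset, Omega}) *)
Definition Filt (k : nat) : set (set Omega) :=
  <<s [set A | exists (j : nat) (i : 'I_p) (B : set R),
                 (j < k)%N /\ measurable B /\ A = w j i @^-1` B] >>.

Definition Fmeas (k : nat) (Y : Omega -> R) : Prop :=
  forall B : set R, measurable B -> Filt k (Y @^-1` B).

Definition is_cond_exp (k : nat) (X Y : Omega -> R) : Prop :=
  Fmeas k Y /\ P.-integrable setT (EFin \o Y) /\
  forall A, Filt k A ->
    (\int[P]_(x in A) (Y x)%:E = \int[P]_(x in A) (X x)%:E)%E.

Definition l2F (k : nat) r (X : Omega -> 'cV[R]_r) : Prop :=
  forall i : 'I_r,
    Fmeas k (fun om => X om i ord0) /\
    measurable_fun setT (fun om => X om i ord0) /\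
    P.-integrable setT (fun om => ((X om i ord0) ^+ 2)%:E).

(* E : a (fixed version of the) conditional expectation operator,
   E k Y = E_k[Y]; vector-valued version applied componentwise. *)
Context (E : nat -> (Omega -> R) -> Omega -> R).
Context (L : LQdata R n m p).

Definition condEv (k : nat) r (X : Omega -> 'cV[R]_r) : Omega -> 'cV[R]_r :=
  fun om => \col_(i < r) E k (fun om' => X om' i ord0) om.

(* a control policy: at time l, maps the current state X_l to u_l *)
Definition policy := nat -> (Omega -> 'cV[R]_n) -> Omega -> 'cV[R]_m.

(* state from the initial pair (s, xi) under the policy ctrl; stX s xi ctrl k = X_k
   for s <= k <= N (and = xi for k <= s) *)
Definition stX (s : nat) (xi : Omega -> 'cV[R]_n) (ctrl : policy) :
    nat -> Omega -> 'cV[R]_n :=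
  fix X k := match k with
  | 0 => xi
  | k'.+1 => if (k' < s)%N then xi else
      let Xk := X k' in let u := ctrl k' Xk in
      let EX := condEv s Xk in let Eu := condEv s u in
      fun om => A_ L s k' *m Xk om + Ab_ L s k' *m EX om
              + B_ L s k' *m u om + Bb_ L s k' *m Eu om + f_ L s k'
              + \sum_(i < p) w k' i om *:
                  (C_ L s k' i *m Xk om + Cb_ L s k' i *m EX om
                   + D_ L s k' i *m u om + Db_ L s k' i *m Eu om + d_ L s k' i)
  end.

Definition Jcost (s : nat) (xi : Omega -> 'cV[R]_n) (ctrl : policy) : Omega -> R :=
  let X := stX s xi ctrl in
  let u := fun k => ctrl k (X k) in
  fun om =>
    \sum_(s <= k < N)
       E s (fun om' => qf (X k om') (Q_ L s k)
                     + qf (condEv s (X k) om') (Qb_ L s k)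
                     + qf (u k om') (R_ L s k)
                     + qf (condEv s (u k) om') (Rb_ L s k)
                     + 2 * dotv (q_ L s k) (X k om')
                     + 2 * dotv (rho_ L s k) (u k om')) om
    + E s (fun om' => qf (X N om') (G_ L s)) om
    + qf (condEv s (X N) om) (Gb_ L s)
    + 2 * dotv (F_ L s *m xi om + g_ L s) (condEv s (X N) om).

Definition Xstar (t : nat) (x : Omega -> 'cV[R]_n) (Phi : nat -> 'M[R]_(m, n))
    (v : nat -> Omega -> 'cV[R]_m) : nat -> Omega -> 'cV[R]_n :=
  fix X k := match k with
  | 0 => x
  | k'.+1 => if (k' < t)%N then x else
      let Xk := X k' in
      fun om => (A_ L k' k' + Ab_ L k' k' + (B_ L k' k' + Bb_ L k' k') *m Phi k') *m Xk om
              + (B_ L k' k' + Bb_ L k' k') *m v k' om + f_ L k' k'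
              + \sum_(i < p) w k' i om *:
                  ((C_ L k' k' i + Cb_ L k' k' i
                    + (D_ L k' k' i + Db_ L k' k' i) *m Phi k') *m Xk om
                   + (D_ L k' k' i + Db_ L k' k' i) *m v k' om + d_ L k' k' i)
  end.

Definition fb (Phi : nat -> 'M[R]_(m, n)) (v : nat -> Omega -> 'cV[R]_m) : policy :=
  fun l X om => Phi l *m X om + v l om.

Definition mixpol (k : nat) (u : Omega -> 'cV[R]_m) (Phi : nat -> 'M[R]_(m, n))
    (v : nat -> Omega -> 'cV[R]_m) : policy :=
  fun l X => if l == k then u else fb Phi v l X.

Definition mixed_equilibrium (t : nat) (x : Omega -> 'cV[R]_n)
    (Phi : nat -> 'M[R]_(m, n)) (v : nat -> Omega -> 'cV[R]_m) : Prop :=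
  (forall k, (t <= k < N)%N -> l2F k (v k)) /\
  forall k, (t <= k < N)%N -> forall u : Omega -> 'cV[R]_m, l2F k u ->
    {ae P, forall om,
       Jcost k (Xstar t x Phi v k) (fb Phi v) om
       <= Jcost k (Xstar t x Phi v k) (mixpol k u Phi v) om}.

(* backward process Y^{k,Phi}; Yrev j = Y_{N-j}; here X = X^{k,Phi}, xk = X^*_k *)
Definition Yrev (k : nat) (Phi : nat -> 'M[R]_(m, n)) (v : nat -> Omega -> 'cV[R]_m)
    (X : nat -> Omega -> 'cV[R]_n) (xk : Omega -> 'cV[R]_n) : nat -> Omega -> 'cV[R]_n :=
  fix Y j := match j with
  | 0 => fun om => G_ L k *m X N om + Gb_ L k *m condEv k (X N) om
                   + F_ L k *m xk om + g_ L k
  | j'.+1 => let l := (N - j'.+1)%N in let Y1 := Y j' in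
      fun om =>
        (Q_ L k l + (Phi l)^T *m R_ L k l *m Phi l) *m X l om
      + (Qb_ L k l + (Phi l)^T *m Rb_ L k l *m Phi l) *m condEv k (X l) om
      + (Phi l)^T *m R_ L k l *m v l om
      + (Phi l)^T *m Rb_ L k l *m condEv k (v l) om
      + (A_ L k l + B_ L k l *m Phi l)^T *m condEv l Y1 om
      + (Ab_ L k l + Bb_ L k l *m Phi l)^T *m condEv k Y1 om
      + \sum_(i < p)
          ((C_ L k l i + D_ L k l i *m Phi l)^T
              *m condEv l (fun om' => w l i om' *: Y1 om') om
         + (Cb_ L k l i + Db_ L k l i *m Phi l)^T
              *m condEv k (fun om' => w l i om' *: Y1 om') om)
      + (Phi l)^T *m rho_ L k l + q_ L k l
  end.

Definition Yproc (t : nat) (x : Omega -> 'cV[R]_n) (Phi : nat -> 'M[R]_(m, n))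
    (v : nat -> Omega -> 'cV[R]_m) (k l : nat) : Omega -> 'cV[R]_n :=
  Yrev k Phi v (stX k (Xstar t x Phi v k) (fb Phi v)) (Xstar t x Phi v k) (N - l).

Definition alpha (k : nat) (Phi : nat -> 'M[R]_(m, n)) (ub : Omega -> 'cV[R]_m) :
    nat -> Omega -> 'cV[R]_n :=
  fix a j := match j with
  | 0 => fun _ => 0
  | j'.+1 => if (j' < k)%N then (fun _ => 0) else
      if j' == k then
        (fun om => (B_ L k k + Bb_ L k k) *m ub om
                 + \sum_(i < p) w k i om *: ((D_ L k k i + Db_ L k k i) *m ub om))
      else let al := a j' in
        fun om => (A_ L k j' + B_ L k j' *m Phi j') *m al om
                + (Ab_ L k j' + Bb_ L k j' *m Phi j') *m condEv k al om
                + \sum_(i < p) w j' i om *: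
                    ((C_ L k j' i + D_ L k j' i *m Phi j') *m al om
                     + (Cb_ L k j' i + Db_ L k j' i *m Phi j') *m condEv k al om)
  end.

Definition Jtilde (k : nat) (Phi : nat -> 'M[R]_(m, n)) (ub : Omega -> 'cV[R]_m) :
    Omega -> R :=
  let a := alpha k Phi ub in
  fun om =>
    \sum_(k <= l < N)
       E k (fun om' => qf (a l om') (Q_ L k l + (Phi l)^T *m R_ L k l *m Phi l)
                     + qf (condEv k (a l) om')
                          (Qb_ L k l + (Phi l)^T *m Rb_ L k l *m Phi l)) om
    + E k (fun om' => qf (ub om') (R_ L k k + Rb_ L k k)) om
    + E k (fun om' => qf (a N om') (G_ L k)) om
    + qf (condEv k (a N) om) (Gb_ L k).

Definition stationarity_convexity (t : nat) (x : Omega -> 'cV[R]_n)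
    (Phi : nat -> 'M[R]_(m, n)) (v : nat -> Omega -> 'cV[R]_m) : Prop :=
  (forall k, (t <= k < N)%N -> l2F k (v k)) /\
  forall k, (t <= k < N)%N ->
    {ae P, forall om,
       0 = (R_ L k k + Rb_ L k k)
             *m (Phi k *m stX k (Xstar t x Phi v k) (fb Phi v) k om + v k om)
         + (B_ L k k + Bb_ L k k)^T *m condEv k (Yproc t x Phi v k k.+1) om
         + \sum_(i < p) (D_ L k k i + Db_ L k k i)^T
              *m condEv k (fun om' => w k i om' *: Yproc t x Phi v k k.+1 om') om
         + rho_ L k k} /\
    (forall ub : Omega -> 'cV[R]_m, l2F k ub ->
       {ae P, forall om, 0 <= Jtilde k Phi ub om}).

End LQ.

(* Main.v *)
Require Import Defs.
From HB Require Import structures.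
From mathcomp Require Import all_boot all_order all_algebra.
From mathcomp Require Import all_classical all_reals all_analysis.
From mathcomp Require Import measurable_realfun ring lra.

Set Implicit Arguments.
Unset Strict Implicit.
Unset Printing Implicit Defensive.

Import Order.TTheory GRing.Theory Num.Theory.
Local Open Scope classical_set_scope.
Local Open Scope ring_scope.

(** Two obstacles shape the proof. First, [E] merely picks some version for each integrand, so it is
    linear, and compatible with almost sure equality, only up to null sets. Sums and products are
    therefore handled modulo [cond_eq], where linearity is exact; almost sure statements are
    extracted only where a conditional expectation enters a recursion, and at the very end. Second,
    a noise times a square-integrable variable is in general only integrable. Two facts repair this,
    both due to the deterministic conditional variance: [w_k Z] stays in L2 when [Z] is
    F_k-measurable and in L2, and [E_k (w_k Y)] is in L2 for every [Y] in L2, by a conditional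
    Cauchy-Schwarz inequality. In the duality between Y and alpha the noise is accordingly always
    shifted onto the adapted factor alpha. The second fact also puts S in L2, so that S itself is an
    admissible direction of perturbation; taking the countable family [- S / (j + 1)] keeps the
    exceptional sets negligible. *)

(** Call two integrable variables equivalent at time [k] when they have the same
    integral over every event of F_k; equivalent F_k-measurable variables agree
    almost surely, and conditional expectations can be inserted, removed and
    pulled out freely under this equivalence.

    Let u_k = Phi_k X_k + v_k + ub be a perturbation of the feedback control at
    time k.  The perturbed state is X + alpha, so the perturbed cost is the
    original one plus a part linear in alpha plus the quadratic part, which is
    Jtilde.  Moving the conditional expectations from alpha to Y, each step of
    the backward recursion of Y absorbs the linear part of one running cost;
    the sum telescopes to 2 S^T ub, where S is the stationarity expression.
    Hence J(u) = J + 2 S^T ub + Jtilde(ub) almost surely.  This is nonnegative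
    when S = 0 and Jtilde >= 0; conversely ub = - S / (j + 1) with j -> oo
    forces S = 0, since Jtilde is homogeneous of degree 2. *)

Lemma max0BmaxN0 (R : realDomainType) (a : R) :
  a = Num.max a 0 - Num.max (- a) 0.
Proof. by case: (leP a 0) => a0; [rewrite max_l|rewrite max_r]; lra. Qed.

Lemma normr_max0 (R : realDomainType) (a : R) : `|Num.max a 0| <= `|a|.
Proof. by case: (leP a 0) => // a0; rewrite normr0. Qed.

(** * Integrable and square-integrable functions *)

Section Integrable.
Context (d : measure_display) (T : measurableType d) (R : realType).
Context (mu : {measure set T -> \bar R}).
Implicit Types (U V : T -> R) (A : set T).

Lemma aeS2 (p q r : T -> Prop) : {ae mu, forall x, p x} ->
  {ae mu, forall x, q x} -> (forall x, p x -> q x -> r x) ->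
  {ae mu, forall x, r x}.
Proof. by move=> hp hq pqr; apply: filterS2 hp hq. Qed.

Definition L1fun U : Prop := mu.-integrable setT (EFin \o U).

Definition L2fun U : Prop := measurable_fun setT U /\ L1fun (fun x => U x ^+ 2).

Local Notation L1 := L1fun.
Local Notation L2 := L2fun.

Lemma L1_measurable U : L1 U -> measurable_fun setT U.
Proof. by move=> /integrableP[/measurable_EFinP]. Qed.

Lemma L1S A U : measurable A -> L1 U -> mu.-integrable A (EFin \o U).
Proof. by move=> mA; apply: integrableS. Qed.

Lemma L1D U V : L1 U -> L1 V -> L1 (fun x => U x + V x).
Proof. exact: integrableD. Qed.

Lemma L1Z (c : R) U : L1 U -> L1 (fun x => c * U x).
Proof. by move=> U1; have := integrableZl measurableT c U1. Qed.

Lemma L1B U V : L1 U -> L1 V -> L1 (fun x => U x - V x).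
Proof.
move=> U1 V1; have := L1D U1 (L1Z (-1) V1).
by congr L1fun; apply/funext => x; rewrite mulN1r.
Qed.

Lemma L1_sum (I : Type) (r : seq I) (F : I -> T -> R) :
  (forall i, L1 (F i)) -> L1 (fun x => \sum_(i <- r) F i x).
Proof.
move=> F1; elim: r => [|i r IHr].
  have := @integrable0 _ T R mu setT.
  by congr (_.-integrable _ _); apply/funext => x; rewrite /= big_nil.
have := L1D (F1 i) IHr.
by congr L1fun; apply/funext => x; rewrite big_cons.
Qed.

Lemma L1_le U V : measurable_fun setT U -> L1 V ->
  {ae mu, forall x, `|U x| <= V x} -> L1 U.
Proof.
move=> mU V1 UV; apply/integrableP; split; first exact/measurable_EFinP.
have /integrableP[mV] := V1; apply: le_lt_trans.
apply: ae_ge0_le_integral => //.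
- by apply: measurableT_comp => //; exact/measurable_EFinP.
- by apply: measurableT_comp.
- apply: filterS UV => x Ux _; rewrite /= lee_fin.
  exact: le_trans Ux (ler_norm _).
Qed.

Lemma L1_ae_eq U V : measurable_fun setT V -> L1 U ->
  {ae mu, forall x, U x = V x} -> L1 V.
Proof.
move=> mV U1 UV; apply: (L1_le mV (integrable_norm U1)).
by apply: filterS UV => x /= ->.
Qed.

Lemma L2_measurable U : L2 U -> measurable_fun setT U.
Proof. by case. Qed.

(** The product is dominated by [U ^+ 2 + V ^+ 2]. *)
Lemma L2M U V : L2 U -> L2 V -> L1 (fun x => U x * V x).
Proof.
move=> [mU U2] [mV V2]; apply: (L1_le _ (L1D U2 V2)).
  exact: measurable_funM.
by apply: aeW => x; rewrite ler_norml; apply/andP; split; nra.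
Qed.

Lemma L2D U V : L2 U -> L2 V -> L2 (fun x => U x + V x).
Proof.
move=> U2 V2; split; first exact: measurable_funD U2.1 V2.1.
have := L1D (L1D U2.2 V2.2) (L1Z 2 (L2M U2 V2)).
by congr L1fun; apply/funext => x; ring.
Qed.

Lemma L2Z (c : R) U : L2 U -> L2 (fun x => c * U x).
Proof.
move=> U2; split; first by apply: measurable_funM => //; exact: U2.1.
have := L1Z (c ^+ 2) U2.2.
by congr L1fun; apply/funext => x; ring.
Qed.

Lemma L2_ae_eq U V : measurable_fun setT V -> L2 U ->
  {ae mu, forall x, U x = V x} -> L2 V.
Proof.
move=> mV [mU U2] UV; split => //; apply: (L1_ae_eq _ U2).
  exact: measurable_funX.
by apply: filterS UV => x ->.
Qed.

End Integrable.

Section FiniteMeasure.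
Context (d : measure_display) (T : measurableType d) (R : realType).
Context (mu : {finite_measure set T -> \bar R}).
Local Notation L1 := (L1fun mu).
Local Notation L2 := (L2fun mu).

Lemma L1_cst (c : R) : L1 (fun=> c).
Proof. exact: finite_measure_integrable_cst. Qed.

Lemma L2_cst (c : R) : L2 (fun=> c).
Proof. by split; [|exact: L1_cst]. Qed.

Lemma L2_L1 (U : T -> R) : L2 U -> L1 U.
Proof.
move=> U2; have := L2M U2 (L2_cst 1).
by congr L1fun; apply/funext => x; rewrite mulr1.
Qed.

Lemma L2_sum (I : Type) (r : seq I) (F : I -> T -> R) :
  (forall i, L2 (F i)) -> L2 (fun x => \sum_(i <- r) F i x).
Proof.
move=> F2; elim: r => [|i r IHr].
  have := L2_cst 0; congr L2fun.
  by apply/funext => x; rewrite big_nil.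
have := L2D (F2 i) IHr.
by congr L2fun; apply/funext => x; rewrite big_cons.
Qed.

End FiniteMeasure.

(** * Equality of conditional expectations *)

Section SubSigmaAlgebra.
Context (d : measure_display) (T : measurableType d) (R : realType).
Context (mu : {measure set T -> \bar R}) (G : set (set T)).
Hypothesis subG : <<s G >> `<=` measurable.

Local Notation TG := (g_sigma_algebraType G).

Lemma sub_measurable_fun (U : T -> R) :
  measurable_fun setT (U : TG -> R) -> measurable_fun setT U.
Proof.
move=> mU _ B mB; rewrite setTI; apply: subG.
by have := mU measurableT B mB; rewrite setTI.
Qed.

Import HBNNSimple.

(** The level sets of [h] lie in the sub-sigma-algebra, so [X] enters only through its integrals
    over events of that sub-sigma-algebra. *)
Lemma ge0_integral_subM_nnsfun (h : {nnsfun TG >-> R}) (X : T -> R) :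
  measurable_fun setT X -> (forall x, 0 <= X x) ->
  (\int[mu]_x (h x * X x)%:E =
   \sum_(y \in range h) y%:E * \int[mu]_(x in h @^-1` [set y]) (X x)%:E)%E.
Proof.
move=> mX X0.
have mh y : measurable (h @^-1` [set y] : set T).
  by apply: subG; exact: (measurable_sfunP h).
transitivity (\int[mu]_x (\sum_(y \in range h)
    (y * \1_(h @^-1` [set y]) x)%:E * (X x)%:E))%E.
  apply: eq_integral => x _; rewrite -ge0_mule_fsuml; last first.
    by move=> y; exact: nnfun_muleindic_ge0.
  by rewrite fsumEFin// -fimfunE EFinM.
have mi y : measurable_fun [set: T] (fun x => y * (\1_(h @^-1` [set y]) x : R)).
  by apply: measurable_funM => //; exact: measurable_indic.
rewrite ge0_integral_fsum//; last 2 first.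
- by move=> y; apply: emeasurable_funM; exact/measurable_EFinP.
- by move=> y x _; rewrite mule_ge0 ?lee_fin ?X0//; exact: nnfun_muleindic_ge0.
apply: eq_fsbigr => y; rewrite inE => -[t _ hty].
have y0 : 0 <= y by rewrite -hty.
under eq_integral do rewrite EFinM -muleA.
rewrite ge0_integralZl//.
- congr (_ * _)%E.
  under eq_integral do rewrite muleC.
  rewrite [RHS]integral_mkcond; apply: eq_integral => x _.
  by rewrite -[RHS]/((_ \_ _) x) epatch_indic.
- by apply: emeasurable_funM; exact/measurable_EFinP.
- by move=> x _; rewrite mule_ge0 ?lee_fin ?X0.
Qed.

(** Simple functions measurable for the sub-sigma-algebra increase to [U], and monotone convergence
    passes to the limit. Nonnegativity replaces integrability of the products, so the lemma can be
    used to prove such integrability. *)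
Lemma ge0_integral_subM (U X Y : T -> R) :
  measurable_fun setT (U : TG -> R) -> (forall x, 0 <= U x) ->
  measurable_fun setT X -> (forall x, 0 <= X x) ->
  measurable_fun setT Y -> (forall x, 0 <= Y x) ->
  (forall A, <<s G >> A ->
    \int[mu]_(x in A) (X x)%:E = \int[mu]_(x in A) (Y x)%:E)%E ->
  (\int[mu]_x (U x * X x)%:E = \int[mu]_x (U x * Y x)%:E)%E.
Proof.
move=> mU U0 mX X0 mY Y0 XY.
have mUe : measurable_fun [set: TG] (EFin \o U) by exact/measurable_EFinP.
pose h := nnsfun_approx measurableT mUe.
have lim_h (Z : T -> R) : measurable_fun setT Z -> (forall x, 0 <= Z x) ->
    (\int[mu]_x (U x * Z x)%:E = limn (fun n => \int[mu]_x (h n x * Z x)%:E))%E.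
  move=> mZ Z0.
  rewrite -(@monotone_convergence _ _ _ mu _ measurableT
      (fun n x => (h n x * Z x)%:E)).
  - apply: eq_integral => x _; apply/esym/cvg_lim => //.
    under eq_fun do rewrite EFinM.
    rewrite EFinM; apply: cvgeZr => //.
    by apply: (cvg_nnsfun_approx measurableT mUe) => // y _; rewrite lee_fin.
  - move=> n; apply/measurable_EFinP; apply: measurable_funM => //.
    by apply: sub_measurable_fun; exact: measurable_funP.
  - by move=> n x _; rewrite lee_fin mulr_ge0.
  - move=> x _ a b ab; rewrite lee_fin ler_wpM2r//.
    by have /lefP/(_ x) := nd_nnsfun_approx measurableT mUe ab.
rewrite !lim_h//; congr (limn _); apply/funext => n.
rewrite !ge0_integral_subM_nnsfun//; apply: eq_fsbigr => y _.
by rewrite XY//; exact: (measurable_sfunP (h n)).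
Qed.

Implicit Types (U V X Y Z : T -> R) (A : set T).
Local Notation L1 := (L1fun mu).
Local Notation L2 := (L2fun mu).
Local Notation measG U := (measurable_fun setT (U : TG -> R)).

(** This is equality of the two conditional expectations given [<<s G >>], expressed without
    choosing versions; neither function has to be measurable for the sub-sigma-algebra. *)
Definition cond_eq U V : Prop := [/\ L1 U, L1 V & forall A, <<s G >> A ->
  (\int[mu]_(x in A) (U x)%:E = \int[mu]_(x in A) (V x)%:E)%E].

Lemma ceq_refl U : L1 U -> cond_eq U U.
Proof. by split. Qed.

Lemma ceq_sym U V : cond_eq U V -> cond_eq V U.
Proof. by case=> U1 V1 UV; split => // A /UV. Qed.

Lemma ceq_trans V U X : cond_eq U V -> cond_eq V X -> cond_eq U X.
Proof. by case=> U1 V1 UV [_ X1 VX]; split => // A GA; rewrite UV// VX. Qed.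

Lemma ceqD U V X Y : cond_eq U V -> cond_eq X Y ->
  cond_eq (fun x => U x + X x) (fun x => V x + Y x).
Proof.
case=> U1 V1 UV [X1 Y1 XY]; split; [exact: L1D|exact: L1D|move=> A GA].
have mA := subG GA.
rewrite !integralD_EFin//; try exact: L1S.
by rewrite UV// XY.
Qed.

Lemma ceqZ (c : R) U V : cond_eq U V ->
  cond_eq (fun x => c * U x) (fun x => c * V x).
Proof.
case=> U1 V1 UV; split; [exact: L1Z|exact: L1Z|move=> A GA].
have mA := subG GA.
under eq_integral do rewrite EFinM.
under [RHS]eq_integral do rewrite EFinM.
rewrite (integralZl mA (L1S mA U1)) (integralZl mA (L1S mA V1)).
by rewrite UV.
Qed.

Lemma ceqB U V X Y : cond_eq U V -> cond_eq X Y ->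
  cond_eq (fun x => U x - X x) (fun x => V x - Y x).
Proof.
move=> UV XY; have := ceqD UV (ceqZ (-1) XY).
by congr cond_eq; apply/funext => x; rewrite mulN1r.
Qed.

Lemma ceq_sum (I : eqType) (r : seq I) (F H : I -> T -> R) :
  (forall i, i \in r -> cond_eq (F i) (H i)) ->
  cond_eq (fun x => \sum_(i <- r) F i x) (fun x => \sum_(i <- r) H i x).
Proof.
elim: r => [_|i r IHr FH].
  rewrite (_ : (fun x => _) = (fun x => \sum_(i <- [::]) H i x)).
    apply: ceq_refl; have := @integrable0 _ T R mu setT.
    by congr (_.-integrable _ _); apply/funext => x; rewrite /= big_nil.
  by apply/funext => x; rewrite !big_nil.
have := ceqD (FH i (mem_head _ _)) (IHr _).
rewrite (_ : (fun x => F i x + _) = (fun x => \sum_(j <- i :: r) F j x)).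
  rewrite (_ : (fun x => H i x + _) = (fun x => \sum_(j <- i :: r) H j x)).
    by apply=> j jr; apply: FH; rewrite inE jr orbT.
  by apply/funext => x; rewrite big_cons.
by apply/funext => x; rewrite big_cons.
Qed.

Lemma ceq_sum_nat (a b : nat) (F H : nat -> T -> R) :
  (forall i, (a <= i < b)%N -> cond_eq (F i) (H i)) ->
  cond_eq (fun x => \sum_(a <= i < b) F i x) (fun x => \sum_(a <= i < b) H i x).
Proof.
by move=> FH; apply: ceq_sum => i; rewrite mem_index_iota; exact: FH.
Qed.

Lemma ceq_ae U V : L1 U -> measurable_fun setT V ->
  {ae mu, forall x, U x = V x} -> cond_eq U V.
Proof.
move=> U1 mV UV; have V1 := L1_ae_eq mV U1 UV; split => // A GA.
apply: ae_eq_integral => //; first exact: subG.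
- by apply: measurable_funTS; apply/measurable_EFinP; exact: L1_measurable U1.
- by apply: measurable_funTS; exact/measurable_EFinP.
- by apply: filterS UV => x ->.
Qed.

Lemma integral_indicM A U : (\int[mu]_(x in A) (U x)%:E =
  \int[mu]_x (\1_A x * U x)%:E)%E.
Proof.
rewrite integral_mkcond; apply: eq_integral => x _.
by rewrite -[LHS]/((_ \_ _) x) epatch_indic/= muleC.
Qed.

(** The positive and negative parts of [X] have the same integral over every event of the
    sub-sigma-algebra, so the nonnegative case applies to them; integrability of [U * X] makes the
    difference of the two integrals meaningful. *)
Lemma ge0_integral_subM0 U X : measG U -> (forall x, 0 <= U x) ->
  L1 X -> (forall A, <<s G >> A -> \int[mu]_(x in A) (X x)%:E = 0)%E ->
  L1 (fun x => U x * X x) -> (\int[mu]_x (U x * X x)%:E = 0)%E.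
Proof.
move=> mU U0 X1 X0 UX1; have mX := L1_measurable X1.
pose p x := Num.max (X x) 0; pose q x := Num.max (- X x) 0.
have mp : measurable_fun setT p by exact: measurable_maxr.
have mq : measurable_fun setT q.
  by apply: measurable_maxr => //; exact: measurable_funN.
have p0 x : 0 <= p x by rewrite /p le_max lexx orbT.
have q0 x : 0 <= q x by rewrite /q le_max lexx orbT.
have pq x : X x = p x - q x by exact: max0BmaxN0.
have pX x : `|p x| <= `|X x| by exact: normr_max0.
have qX x : `|q x| <= `|X x| by rewrite -(normrN (X x)); exact: normr_max0.
have mU' := sub_measurable_fun mU.
have Up1 : L1 (fun x => U x * p x).
  apply: (L1_le _ (integrable_norm UX1)); first exact: measurable_funM.
  by apply: aeW => x; rewrite /= !normrM ler_wpM2l.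
have Uq1 : L1 (fun x => U x * q x).
  apply: (L1_le _ (integrable_norm UX1)); first exact: measurable_funM.
  by apply: aeW => x; rewrite /= !normrM ler_wpM2l.
under eq_integral do rewrite pq mulrBr.
rewrite (integralB_EFin measurableT Up1 Uq1).
rewrite (@ge0_integral_subM U p q)//.
  by rewrite subee//; exact: (integrable_fin_num measurableT Uq1).
move=> A GA; have mA := subG GA.
have p1 : L1 p by apply: (L1_le mp (integrable_norm X1)); exact: aeW.
have q1 : L1 q by apply: (L1_le mq (integrable_norm X1)); exact: aeW.
have := X0 A GA; under eq_integral do rewrite pq.
rewrite (integralB_EFin mA (L1S mA p1) (L1S mA q1)).
by move=> /eqP; rewrite sube_eq ?add0e ?(integrable_fin_num mA (L1S mA _))//
  => /eqP.
Qed.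

(** Now the multiplier [U] is split into its positive and negative parts. *)
Lemma integral_subM0 U X : measG U ->
  L1 X -> (forall A, <<s G >> A -> \int[mu]_(x in A) (X x)%:E = 0)%E ->
  L1 (fun x => U x * X x) -> (\int[mu]_x (U x * X x)%:E = 0)%E.
Proof.
move=> mU X1 X0 UX1; have mX := L1_measurable X1.
pose p x := Num.max (U x) 0; pose q x := Num.max (- U x) 0.
have mp : measG p by exact: measurable_maxr.
have mq : measG q by apply: measurable_maxr => //; exact: measurable_funN.
have p0 x : 0 <= p x by rewrite /p le_max lexx orbT.
have q0 x : 0 <= q x by rewrite /q le_max lexx orbT.
have pq x : U x = p x - q x by exact: max0BmaxN0.
have pU x : `|p x| <= `|U x| by exact: normr_max0.
have qU x : `|q x| <= `|U x| by rewrite -(normrN (U x)); exact: normr_max0.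
have pX1 : L1 (fun x => p x * X x).
  apply: (L1_le _ (integrable_norm UX1)).
    by apply: measurable_funM => //; exact: sub_measurable_fun.
  by apply: aeW => x; rewrite /= !normrM ler_wpM2r.
have qX1 : L1 (fun x => q x * X x).
  apply: (L1_le _ (integrable_norm UX1)).
    by apply: measurable_funM => //; exact: sub_measurable_fun.
  by apply: aeW => x; rewrite /= !normrM ler_wpM2r.
under eq_integral do rewrite pq mulrBl.
rewrite (integralB_EFin measurableT pX1 qX1).
by rewrite !ge0_integral_subM0// subee.
Qed.

(** Taking out what is known: on an event [A], the multiplier [\1_A * Z] is integrated against
    [U - V], whose integrals over the sub-sigma-algebra all vanish. The factors are only integrable,
    hence the separate assumptions on the products. *)
Lemma ceqM Z U V : measG Z -> cond_eq U V ->
  L1 (fun x => Z x * U x) -> L1 (fun x => Z x * V x) ->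
  cond_eq (fun x => Z x * U x) (fun x => Z x * V x).
Proof.
move=> mZ [U1 V1 UV] ZU1 ZV1; split => // A GA.
have mA := subG GA.
have fA W : L1 W -> (\int[mu]_(x in A) (W x)%:E)%E \is a fin_num.
  by move=> W1; exact: (integrable_fin_num mA (L1S mA W1)).
suff : (\int[mu]_(x in A) (Z x * U x)%:E - \int[mu]_(x in A) (Z x * V x)%:E
    = 0)%E.
  move=> /eqP; rewrite sube_eq ?add0e; first by move=> /eqP.
    exact: fA.
  by apply: fin_num_adde_defl; exact: fA.
rewrite -(integralB_EFin mA (L1S mA ZU1) (L1S mA ZV1)) integral_indicM.
under eq_integral do rewrite -mulrBr mulrA.
apply: integral_subM0.
- by apply: measurable_funM => //; exact: measurable_indic.
- exact: L1B.
- move=> B GB; have mB := subG GB.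
  rewrite (integralB_EFin mB (L1S mB U1) (L1S mB V1)) UV// subee//.
  exact: (integrable_fin_num mB (L1S mB V1)).
- apply: (L1_le _ (integrable_norm (L1B ZU1 ZV1))).
    apply: measurable_funM; last exact: L1_measurable (L1B U1 V1).
    apply: measurable_funM; first exact: measurable_indic.
    exact: sub_measurable_fun.
  apply: aeW => x /=; rewrite -mulrBr -mulrA normrM ler_piMl//.
  by rewrite indicE; case: (_ \in _); rewrite ?normr1 ?normr0.
Qed.

(** The set where [U < 0] is an event of the sub-sigma-algebra, so the integral of [U] over it
    equals that of [X] and is nonnegative; hence the negative part of [U] has zero integral. *)
Lemma ae_ge0_ceq U X : measG U -> cond_eq U X -> (forall x, 0 <= X x) ->
  {ae mu, forall x, 0 <= U x}.
Proof.
move=> mU [U1 X1 UX] X0; pose A := [set x | U x < 0].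
have GA : <<s G >> A.
  have := mU measurableT _ (measurable_itv `]-oo, 0[%R).
  rewrite setTI; congr (<<s G >>); apply/seteqP; split => x /=;
    by rewrite in_itv.
have mA := subG GA; pose q x := Num.max (- U x) 0.
have mq : measurable_fun setT q.
  apply: measurable_maxr => //; apply: measurable_funN.
  exact: L1_measurable U1.
have : (\int[mu]_x `|(q x)%:E| = 0)%E.
  apply/eqP; rewrite eq_le integral_ge0 ?andbT//.
  rewrite (_ : (\int[mu]_x _) = - \int[mu]_(x in A) (U x)%:E)%E.
    by rewrite leeNl oppe0 UX// integral_ge0// => x _; rewrite lee_fin.
  transitivity (\int[mu]_(x in A) (- U x)%:E)%E.
    rewrite [RHS]integral_indicM; apply: eq_integral => x _.
    rewrite gee0_abs ?lee_fin ?le_max ?lexx ?orbT//; congr EFin.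
    rewrite indicE /q; case: (boolP (x \in A)); rewrite ?inE/= => Ux.
      by rewrite mul1r max_l// oppr_ge0 ltW.
    rewrite mul0r max_r// oppr_le0 leNgt; apply/negP => Ux'.
    by case/negP: Ux; rewrite inE.
  rewrite -integralN/=; first by apply: eq_integral.
  apply: fin_num_adde_defl; rewrite fin_numN.
  exact: (integrable_neg_fin_num mA (L1S mA U1)).
move/(ae_eq_integral_abs mu measurableT (proj2 (measurable_EFinP _ _) mq)).1.
apply: filterS => x /(_ Logic.I) []; rewrite /q.
by case: (leP (- U x) 0) => [|_ /eqP]; rewrite ?oppr_le0// oppr_eq0 => /eqP->.
Qed.

Lemma ae_eq_ceq U V : measG U -> measG V -> cond_eq U V ->
  {ae mu, forall x, U x = V x}.
Proof.
move=> mU mV UV.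
have [U1 V1 _] := UV.
have hle W W' : measG W -> measG W' -> cond_eq W W' ->
    {ae mu, forall x, 0 <= W x - W' x}.
  move=> mW mW' WW'; have [W1 W'1 _] := WW'.
  apply: (@ae_ge0_ceq _ (fun=> 0)) => //; first exact: measurable_funB.
  have := ceqB WW' (ceq_refl W'1); congr cond_eq.
  by apply/funext => x; rewrite subrr.
have H1 := hle _ _ mU mV UV.
have H2 := hle _ _ mV mU (ceq_sym UV).
by apply: (aeS2 H1 H2) => x; lra.
Qed.

(* Conditional Cauchy--Schwarz: the discriminant of [a |-> E[(X - a W)^2]],
   which is nonnegative a.e. for all rational [a] at once. *)
Lemma ceq_cauchy_schwarz (X W p q s : T -> R) (c : R) :
  L2 X -> L2 W -> measG p -> measG q -> measG s -> 0 < c ->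
  cond_eq q (fun x => X x * W x) -> cond_eq p (fun x => X x ^+ 2) ->
  cond_eq s (fun x => W x ^+ 2) -> {ae mu, forall x, s x <= c} ->
  {ae mu, forall x, q x ^+ 2 <= c * p x}.
Proof.
move=> X2 W2 mp mq ms c0 qE pE sE sc.
have H (a : R) : {ae mu, forall x, 0 <= p x - (2 * a) * q x + a ^+ 2 * s x}.
  apply: (@ae_ge0_ceq _ (fun x => (X x - a * W x) ^+ 2)).
  - apply: measurable_funD; first apply: measurable_funB => //.
      exact: measurable_funM.
    exact: measurable_funM.
  - have := ceqD (ceqB pE (ceqZ (2 * a) qE)) (ceqZ (a ^+ 2) sE).
    by congr cond_eq; apply/funext => x; ring.
  - by move=> x; exact: sqr_ge0.
have Hn : {ae mu, forall x, forall n, if @unpickle rat n is Some r then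
    0 <= p x - (2 * ratr r) * q x + ratr r ^+ 2 * s x else true}.
  apply: ae_foralln => n; case: (unpickle n) => [r|]; first exact: H.
  exact: aeW.
apply: filterS2 Hn sc => x Hx sx.
rewrite leNgt; apply/negP => lt_pq.
(* With [s x] bounded by [c], the quadratic is at most [c * (a - a0) ^+ 2 - e], where [a0 = q x / c]
   is its minimiser. It is negative for [a] within [b] of [a0], and some rational lies in that
   range. *)
pose e := q x ^+ 2 / c - p x.
have e0 : 0 < e by rewrite /e subr_gt0 ltr_pdivlMr// mulrC.
pose a0 := q x / c; pose b := Num.sqrt (e / c).
have b0 : 0 < b by rewrite sqrtr_gt0 divr_gt0.
have [r] : exists r, ratr r \in `]a0, (a0 + b)[%R by apply: rat_in_itvoo; lra.
rewrite in_itv/= => /andP[ra rb].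
have := Hx (pickle r); rewrite pickleK.
have b2 : b ^+ 2 * c = e by rewrite sqr_sqrtr ?divfK ?gt_eqF// ltW// divr_gt0.
have qa : q x = a0 * c by rewrite divfK// gt_eqF.
have : (ratr r - a0) ^+ 2 < b ^+ 2 by rewrite ltr_pXn2r ?nnegrE//; lra.
move: (ratr r) => t tb.
have t2 : t ^+ 2 * s x <= t ^+ 2 * c by rewrite ler_wpM2l// sqr_ge0.
have : (t - a0) ^+ 2 * c < b ^+ 2 * c by rewrite ltr_pM2r.
have -> : b ^+ 2 * c = a0 ^+ 2 * c - p x.
  by rewrite b2 /e qa exprMn; field; rewrite gt_eqF.
by rewrite qa; nra.
Qed.

End SubSigmaAlgebra.

(** * Random vectors adapted to the noise filtration *)

Section Dotv.
Context (R : realType).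

Lemma dotvE r (a b : 'cV[R]_r) : dotv a b = \sum_i a i ord0 * b i ord0.
Proof. by rewrite /dotv mxE; apply: eq_bigr => i _; rewrite mxE. Qed.

Lemma dotvC r (a b : 'cV[R]_r) : dotv a b = dotv b a.
Proof. by rewrite !dotvE; apply: eq_bigr => i _; rewrite mulrC. Qed.

Lemma dotvDl r (a b c : 'cV[R]_r) : dotv (a + b) c = dotv a c + dotv b c.
Proof. by rewrite /dotv linearD mulmxDl mxE. Qed.

Lemma dotvDr r (a b c : 'cV[R]_r) : dotv a (b + c) = dotv a b + dotv a c.
Proof. by rewrite /dotv mulmxDr mxE. Qed.

Lemma dotvZr r (k : R) (a b : 'cV[R]_r) : dotv a (k *: b) = k * dotv a b.
Proof. by rewrite /dotv -scalemxAr mxE. Qed.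

Lemma dotvZl r (k : R) (a b : 'cV[R]_r) : dotv (k *: a) b = k * dotv a b.
Proof. by rewrite dotvC dotvZr dotvC. Qed.

Lemma dotv0 r (a : 'cV[R]_r) : dotv a 0 = 0.
Proof. by rewrite /dotv mulmx0 mxE. Qed.

Lemma dotv_suml r (I : Type) (s : seq I) (F : I -> 'cV[R]_r) (b : 'cV[R]_r) :
  dotv (\sum_(i <- s) F i) b = \sum_(i <- s) dotv (F i) b.
Proof. by rewrite /dotv linear_sum/= mulmx_suml summxE. Qed.

Lemma dotv_sumr r (I : Type) (s : seq I) (F : I -> 'cV[R]_r) (a : 'cV[R]_r) :
  dotv a (\sum_(i <- s) F i) = \sum_(i <- s) dotv a (F i).
Proof. by rewrite dotvC dotv_suml; apply: eq_bigr => i _; rewrite dotvC. Qed.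

Lemma dotv_mulmxl r s (M : 'M[R]_(s, r)) (a : 'cV[R]_r) (b : 'cV[R]_s) :
  dotv (M *m a) b = dotv a (M^T *m b).
Proof. by rewrite /dotv trmx_mul mulmxA. Qed.

Lemma dotv_mulmxr r s (M : 'M[R]_(s, r)) (a : 'cV[R]_r) (b : 'cV[R]_s) :
  dotv b (M *m a) = dotv (M^T *m b) a.
Proof. by rewrite dotv_mulmxl trmxK. Qed.

Lemma dotv_ge0 r (a : 'cV[R]_r) : 0 <= dotv a a.
Proof. by rewrite dotvE; apply: sumr_ge0 => i _; rewrite -expr2 sqr_ge0. Qed.

Lemma dotv_eq0 r (a : 'cV[R]_r) : dotv a a = 0 -> a = 0.
Proof.
rewrite dotvE => /eqP; rewrite psumr_eq0; last first.
  by move=> i _; rewrite -expr2 sqr_ge0.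
move=> /allP a0; apply/matrixP => i j; rewrite ord1 mxE.
by have := a0 i; rewrite mem_index_enum mulf_eq0 orbb => /(_ isT)/eqP.
Qed.

Lemma qfE r (a : 'cV[R]_r) (M : 'M[R]_r) : qf a M = dotv a (M *m a).
Proof. by rewrite /qf /dotv mulmxA. Qed.

Lemma qfD r (a b : 'cV[R]_r) (M : 'M[R]_r) : M^T = M ->
  qf (a + b) M = qf a M + 2 * dotv (M *m a) b + qf b M.
Proof.
move=> MT; rewrite !qfE mulmxDr !dotvDl !dotvDr (dotvC a (M *m b)).
by rewrite [dotv (M *m b) a]dotv_mulmxl MT (dotvC _ b); ring.
Qed.

Lemma qf_addM r (a : 'cV[R]_r) (M M' : 'M[R]_r) :
  qf a (M + M') = qf a M + qf a M'.
Proof. by rewrite !qfE mulmxDl dotvDr. Qed.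

Lemma qf_mulmx r s (a : 'cV[R]_r) (M : 'M[R]_s) (K : 'M[R]_(s, r)) :
  qf (K *m a) M = qf a (K^T *m M *m K).
Proof. by rewrite !qfE dotv_mulmxl !mulmxA. Qed.

Lemma qf0 r (M : 'M[R]_r) : qf 0 M = 0.
Proof. by rewrite qfE mulmx0 dotv0. Qed.

Lemma qfZ r (k : R) (a : 'cV[R]_r) (M : 'M[R]_r) :
  qf (k *: a) M = k ^+ 2 * qf a M.
Proof. by rewrite !qfE -scalemxAr dotvZl dotvZr mulrA. Qed.

End Dotv.

Section VectorPredicate.
Context (R : realType) (T : Type) (Q : (T -> R) -> Prop).
Hypothesis Q_cst : forall c, Q (fun=> c).
Hypothesis Q_D : forall U V, Q U -> Q V -> Q (fun x => U x + V x).
Hypothesis Q_Z : forall c U, Q U -> Q (fun x => c * U x).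

(** Kept abstract in [Q] so that the same closure proofs serve [L2v] and [l2F k]; the latter is
    [vpred] for the conjunction of F_k-measurability and square integrability. *)
Definition vpred r (X : T -> 'cV[R]_r) : Prop :=
  forall i, Q (fun x => X x i ord0).

Lemma vpred_cst r (c : 'cV[R]_r) : vpred (fun=> c).
Proof. by move=> i; exact: Q_cst. Qed.

Lemma vpredD r (X Y : T -> 'cV[R]_r) :
  vpred X -> vpred Y -> vpred (fun x => X x + Y x).
Proof.
move=> QX QY i; have := Q_D (QX i) (QY i).
by congr Q; apply/funext => x; rewrite mxE.
Qed.

Lemma vpredM r s (M : 'M[R]_(s, r)) (X : T -> 'cV[R]_r) :
  vpred X -> vpred (fun x => M *m X x).
Proof.
move=> QX i.
rewrite (_ : (fun x => _) = (fun x => \sum_j M i j * X x j ord0)); last first.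
  by apply/funext => x; rewrite mxE.
elim: (index_enum _) => [|j e IHe].
  have := Q_cst 0; congr Q; by apply/funext => x; rewrite big_nil.
have := Q_D (Q_Z (M i j) (QX j)) IHe.
by congr Q; apply/funext => x; rewrite big_cons.
Qed.

Lemma vpred_sum (I : Type) (e : seq I) r (F : I -> T -> 'cV[R]_r) :
  (forall i, vpred (F i)) -> vpred (fun x => \sum_(i <- e) F i x).
Proof.
move=> QF; elim: e => [|i e IHe].
  have := @vpred_cst r 0.
  by congr vpred; apply/funext => x; rewrite big_nil.
have := vpredD (QF i) IHe.
by congr vpred; apply/funext => x; rewrite big_cons.
Qed.

End VectorPredicate.

(** * Conditional expectations along the noise filtration *)

Section Filtration.
Context (R : realType) (dsp : measure_display) (Omega : measurableType dsp)
  (P : probability Omega R) (N p : nat) (w : nat -> 'I_p -> Omega -> R)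
  (Delta : nat -> 'M[R]_p) (E : nat -> (Omega -> R) -> Omega -> R).
Hypothesis Hw_meas : forall k (i : 'I_p), (k < N)%N ->
  measurable_fun setT (w k i).
Hypothesis Hw_sq : forall k (i : 'I_p), (k < N)%N ->
  P.-integrable setT (fun om => ((w k i om) ^+ 2)%:E).
Hypothesis HE : forall k, (k < N)%N -> forall X : Omega -> R,
  P.-integrable setT (EFin \o X) -> is_cond_exp P w k X (E k X).
Hypothesis Hw_cov : forall k (i j : 'I_p), (k < N)%N ->
  {ae P, forall om, E k (fun om' => w k i om' * w k j om') om = Delta k i j}.

Implicit Types (U V X Y Z : Omega -> R) (k l : nat).
Local Notation Fmeas := (Fmeas w).
Local Notation Filt := (Filt w).
Local Notation L1 := (L1fun P).
Local Notation L2 := (L2fun P).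

(** The generating family of [Filt k], named so that the results on [<<s G >>] apply to the
    filtration. *)
Definition Fgen k : set (set Omega) :=
  [set A | exists (j : nat) (i : 'I_p) (B : set R),
     (j < k)%N /\ measurable B /\ A = w j i @^-1` B].

Local Notation ceq k := (cond_eq P (Fgen k)).

Lemma Filt_measurable k : (k <= N)%N -> Filt k `<=` measurable.
Proof.
move=> kN; apply: smallest_sub; first exact: sigma_algebra_measurable.
move=> _ [j [i [B [jk [mB ->]]]]].
have := Hw_meas i (leq_trans jk kN) measurableT mB.
by rewrite setTI.
Qed.

Lemma FiltW k l : (k <= l)%N -> Filt k `<=` Filt l.
Proof.
move=> kl; apply: sub_sigma_algebra2 => _ [j [i [B [jk [mB ->]]]]].
by exists j, i, B; split => //; exact: leq_trans jk kl.
Qed.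

Lemma FmeasP k U : Fmeas k U <->
  measurable_fun setT (U : g_sigma_algebraType (Fgen k) -> R).
Proof.
split=> [FU _ B mB|mU B mB]; first by rewrite setTI; exact: FU.
by have := mU measurableT B mB; rewrite setTI.
Qed.

Lemma FmeasW k l U : (k <= l)%N -> Fmeas k U -> Fmeas l U.
Proof. by move=> kl FU B mB; apply: FiltW kl _ _; exact: FU. Qed.

Lemma Fmeas_measurable k U : (k <= N)%N -> Fmeas k U -> measurable_fun setT U.
Proof.
move=> kN /FmeasP; apply: sub_measurable_fun.
exact: Filt_measurable.
Qed.

Lemma Fmeas_cst k (c : R) : Fmeas k (fun=> c).
Proof. by apply/FmeasP; exact: measurable_cst. Qed.

Lemma FmeasD k U V : Fmeas k U -> Fmeas k V -> Fmeas k (fun om => U om + V om).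
Proof.
by move=> /FmeasP FU /FmeasP FV; apply/FmeasP; exact: measurable_funD.
Qed.

Lemma FmeasM k U V : Fmeas k U -> Fmeas k V -> Fmeas k (fun om => U om * V om).
Proof.
by move=> /FmeasP FU /FmeasP FV; apply/FmeasP; exact: measurable_funM.
Qed.

Lemma FmeasZ k (c : R) U : Fmeas k U -> Fmeas k (fun om => c * U om).
Proof. by apply: FmeasM; exact: Fmeas_cst. Qed.

Lemma Fmeas_sum k (I : eqType) (s : seq I) (F : I -> Omega -> R) :
  (forall i, i \in s -> Fmeas k (F i)) ->
  Fmeas k (fun om => \sum_(i <- s) F i om).
Proof.
elim: s => [_|i s IHs FF].
  have := @Fmeas_cst k 0; congr Defs.Fmeas.
  by apply/funext => om; rewrite big_nil.
have Fs : Fmeas k (fun om => \sum_(i <- s) F i om).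
  by apply: IHs => j js; apply: FF; rewrite inE js orbT.
have := FmeasD (FF i (mem_head _ _)) Fs; congr Defs.Fmeas.
by apply/funext => om; rewrite big_cons.
Qed.

Lemma Fmeas_noise k i : Fmeas k.+1 (w k i).
Proof.
move=> B mB; apply: sub_sigma_algebra.
by exists k, i, B.
Qed.

Lemma ceqW k l U V : (k <= l)%N -> ceq l U V -> ceq k U V.
Proof.
by move=> kl [U1 V1 UV]; split => // A FA; apply: UV; exact: FiltW kl _ FA.
Qed.

Lemma E_Fmeas k U : (k < N)%N -> L1 U -> Fmeas k (E k U).
Proof. by move=> kN U1; case: (HE kN U1). Qed.

Lemma E_ceq k U : (k < N)%N -> L1 U -> ceq k (E k U) U.
Proof. by move=> kN U1; case: (HE kN U1) => _ []; split. Qed.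

Lemma Fmeas_ceq_ae_eq k U V : (k <= N)%N -> Fmeas k U -> Fmeas k V ->
  ceq k U V -> {ae P, forall om, U om = V om}.
Proof.
move=> kN /FmeasP FU /FmeasP FV.
by apply: ae_eq_ceq => //; exact: Filt_measurable.
Qed.

Lemma L2_noise k i : (k < N)%N -> L2 (w k i).
Proof. by move=> kN; split; [exact: Hw_meas|exact: Hw_sq]. Qed.

(** A conditional second moment is almost surely nonnegative, so the truncation changes nothing; it
    provides a constant that is nonnegative by construction. *)
Lemma noise_var k i : (k < N)%N ->
  {ae P, forall om, E k (fun om => w k i om ^+ 2) om = Num.max (Delta k i i) 0}.
Proof.
move=> kN; have w1 : L1 (fun om => w k i om ^+ 2) by exact: Hw_sq.
have Ew0 : {ae P, forall om, 0 <= E k (fun om => w k i om ^+ 2) om}.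
  apply: (ae_ge0_ceq (Filt_measurable (ltnW kN)) _ (E_ceq kN w1)).
    by apply/FmeasP; exact: E_Fmeas.
  by move=> om; exact: sqr_ge0.
apply: (aeS2 Ew0 (Hw_cov i i kN)) => om Ew EwD.
by rewrite /= -EwD max_l.
Qed.

(* The conditional variance of the noise is deterministic: this is what keeps
   the products of noise and adapted square-integrable variables in [L2]. *)
Lemma L2_noiseM k i Z : (k < N)%N -> Fmeas k Z -> L2 Z ->
  L2 (fun om => w k i om * Z om).
Proof.
move=> kN FZ [mZ Z2].
have mw := Hw_meas i kN.
have sF := Filt_measurable (ltnW kN).
have w1 : L1 (fun om => w k i om ^+ 2) by exact: Hw_sq.
have mwZ : measurable_fun setT (fun om => w k i om * Z om).
  exact: measurable_funM.
split => //; apply/integrableP; split.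
  by apply/measurable_EFinP; exact: measurable_funX.
set c := Num.max (Delta k i i) 0.
have c0 : 0 <= c by rewrite /c le_max lexx orbT.
rewrite (_ : (\int[P]_x _ = \int[P]_x (Z x ^+ 2 * w k i x ^+ 2)%:E)%E);
  last first.
  apply: eq_integral => om _ /=.
  by rewrite ger0_norm ?sqr_ge0// exprMn mulrC.
(* Under the F_k-measurable weight [Z ^+ 2], the square of the noise is exchanged for its
   conditional variance [c]. The nonnegative version is required, since integrability of the product
   is the claim. *)
rewrite (@ge0_integral_subM _ _ _ P (Fgen k) sF _ _ (fun=> c)) //.
- have /integrableP[_] := L1Z c Z2; congr (_ < _)%E.
  apply: eq_integral => om _ /=.
  by rewrite [c * _]mulrC ger0_norm// mulr_ge0 ?sqr_ge0.
- by apply/FmeasP; exact: (FmeasM FZ FZ).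
- by move=> om; exact: sqr_ge0.
- exact: measurable_funX.
- by move=> om; exact: sqr_ge0.
- have [_ _ wE] := E_ceq kN w1.
  have [_ _ cE] := @ceq_ae _ _ _ P (Fgen k) sF _ (fun=> c)
    (let: And3 E1 _ _ := E_ceq kN w1 in E1) (measurable_cst _) (noise_var i kN).
  by move=> A FA; rewrite -wE// cE.
Qed.

(** Conditional Cauchy-Schwarz bounds the square of [E_k (X W)] by [c * E_k (X ^+ 2)], which is
    integrable. The choice [W = 1] gives stability of L2 under [E k], and [W = w k i] handles the
    noise terms of the adjoint equation. *)
Lemma L2_E_of_var k W (c : R) X s : (k < N)%N -> L2 W -> 0 < c -> Fmeas k s ->
  ceq k s (fun om => W om ^+ 2) -> {ae P, forall om, s om <= c} -> L2 X ->
  L2 (E k (fun om => X om * W om)).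
Proof.
move=> kN W2 c0 Fs sE sc X2; have XW1 := L2M X2 W2.
have sF := Filt_measurable (ltnW kN).
have mE := Fmeas_measurable (ltnW kN) (E_Fmeas kN XW1).
split => //.
have p1 : L1 (E k (fun om => X om ^+ 2)) by case: (E_ceq kN X2.2).
apply: (L1_le _ (L1Z c p1)); first exact: measurable_funX.
have := @ceq_cauchy_schwarz _ _ _ P (Fgen k) sF X W _ _ s c X2 W2
  (proj1 (FmeasP _ _) (E_Fmeas kN X2.2)) (proj1 (FmeasP _ _) (E_Fmeas kN XW1))
  (proj1 (FmeasP _ _) Fs) c0 (E_ceq kN XW1) (E_ceq kN X2.2) sE sc.
by apply: filterS => om qp; rewrite ger0_norm// sqr_ge0.
Qed.

Lemma L2_E k X : (k < N)%N -> L2 X -> L2 (E k X).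
Proof.
move=> kN X2.
have := @L2_E_of_var k (fun=> 1) 1 X (fun=> 1) kN (L2_cst _ _) ltr01
  (@Fmeas_cst _ _) _ (aeW _ _) X2.
rewrite (_ : (fun om => X om * 1) = X); last first.
  by apply/funext => om; rewrite mulr1.
apply => //; rewrite (_ : (fun=> 1 ^+ 2) = fun=> 1 :> R); last first.
  by apply/funext => om; rewrite expr1n.
by apply: ceq_refl; exact: L1_cst.
Qed.

Lemma L2_E_noise k i X : (k < N)%N -> L2 X ->
  L2 (E k (fun om => w k i om * X om)).
Proof.
move=> kN X2; have w1 : L1 (fun om => w k i om ^+ 2) by exact: Hw_sq.
rewrite (_ : (fun om => _) = (fun om => X om * w k i om)); last first.
  by apply/funext => om; rewrite mulrC.
(* Adding 1 makes the bound strictly positive even for a degenerate noise. *)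
apply: (@L2_E_of_var k _ (Num.max (Delta k i i) 0 + 1) _
  (E k (fun om => w k i om ^+ 2))) => //.
- exact: L2_noise.
- by rewrite ltr_wpDl// le_max lexx orbT.
- exact: E_Fmeas.
- exact: E_ceq.
- by apply: filterS (noise_var i kN) => om ->; rewrite lerDl.
Qed.

Local Notation L2v := (vpred L2).
Local Notation l2F := (l2F P w).
Local Notation condEv := (condEv E).

Lemma L2v_cst r (c : 'cV[R]_r) : L2v (fun=> c).
Proof. by apply: vpred_cst => ?; exact: L2_cst. Qed.

Lemma L2vD r (X Y : Omega -> 'cV[R]_r) :
  L2v X -> L2v Y -> L2v (fun om => X om + Y om).
Proof. by apply: vpredD => ? ?; exact: L2D. Qed.

Lemma L2vM r s (M : 'M[R]_(s, r)) (X : Omega -> 'cV[R]_r) :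
  L2v X -> L2v (fun om => M *m X om).
Proof.
by apply: vpredM => [?|? ?|? ?]; [exact: L2_cst|exact: L2D|exact: L2Z].
Qed.

Lemma L2v_sum (I : Type) (e : seq I) r (F : I -> Omega -> 'cV[R]_r) :
  (forall i, L2v (F i)) -> L2v (fun om => \sum_(i <- e) F i om).
Proof.
by apply: vpred_sum => [?|? ?]; [exact: L2_cst|exact: L2D].
Qed.

Lemma l2F_cst k r (c : 'cV[R]_r) : l2F k (fun=> c).
Proof. by move=> i; split; [exact: Fmeas_cst|exact: L2_cst]. Qed.

Lemma l2FD k r (X Y : Omega -> 'cV[R]_r) :
  l2F k X -> l2F k Y -> l2F k (fun om => X om + Y om).
Proof.
apply: (@vpredD _ _ (fun U => Fmeas k U /\ L2 U)) => U V [FU U2] [FV V2].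
by split; [exact: FmeasD|exact: L2D].
Qed.

Lemma l2FM k r s (M : 'M[R]_(s, r)) (X : Omega -> 'cV[R]_r) :
  l2F k X -> l2F k (fun om => M *m X om).
Proof.
apply: (@vpredM _ _ (fun U => Fmeas k U /\ L2 U)) =>
  [c|U V [FU U2] [FV V2]|c U [FU U2]]; split.
- exact: Fmeas_cst.
- exact: L2_cst.
- exact: FmeasD.
- exact: L2D.
- exact: FmeasZ.
- exact: L2Z.
Qed.

Lemma l2F_sum k (I : Type) (e : seq I) r (F : I -> Omega -> 'cV[R]_r) :
  (forall i, l2F k (F i)) -> l2F k (fun om => \sum_(i <- e) F i om).
Proof.
apply: (@vpred_sum _ _ (fun U => Fmeas k U /\ L2 U)) =>
  [c|U V [FU U2] [FV V2]]; split.
- exact: Fmeas_cst.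
- exact: L2_cst.
- exact: FmeasD.
- exact: L2D.
Qed.

Lemma l2FZ k r (c : R) (X : Omega -> 'cV[R]_r) :
  l2F k X -> l2F k (fun om => c *: X om).
Proof.
move=> /(l2FM c%:M); congr Defs.l2F.
by apply/funext => om; rewrite mul_scalar_mx.
Qed.

Lemma l2FB k r (X Y : Omega -> 'cV[R]_r) :
  l2F k X -> l2F k Y -> l2F k (fun om => X om - Y om).
Proof.
move=> FX /(l2FZ (-1)) /(l2FD FX); congr Defs.l2F.
by apply/funext => om; rewrite scaleN1r.
Qed.

Lemma l2FI k r (X : Omega -> 'cV[R]_r) :
  (forall i, Fmeas k (fun om => X om i ord0)) -> L2v X -> l2F k X.
Proof. by move=> FX X2 i; split; [exact: FX|exact: X2]. Qed.

Lemma l2F_L2v k r (X : Omega -> 'cV[R]_r) : l2F k X -> L2v X.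
Proof. by move=> FX i; have [] := FX i. Qed.

Lemma l2FW k l r (X : Omega -> 'cV[R]_r) : (k <= l)%N -> l2F k X -> l2F l X.
Proof.
by move=> kl FX i; have [FXi ?] := FX i; split => //; exact: FmeasW FXi.
Qed.

Lemma condEvE k r (X : Omega -> 'cV[R]_r) i :
  (fun om => condEv k X om i ord0) = E k (fun om => X om i ord0).
Proof. by apply/funext => om; rewrite mxE. Qed.

Lemma l2F_condE k r (X : Omega -> 'cV[R]_r) :
  (k < N)%N -> L2v X -> l2F k (condEv k X).
Proof.
move=> kN X2; apply: l2FI => i; rewrite condEvE; last exact: L2_E.
by apply: E_Fmeas => //; exact: L2_L1.
Qed.

(** Only the variance of [w l i] given F_l is known to be deterministic. By the tower property the
    variable is almost surely [E_k] of [E_l (w_l X)]: the inner expectation is in L2 by [L2_E_noise]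
    at time [l], the outer one by [L2_E]. *)
Lemma L2_E_noiseW k l i X : (k <= l < N)%N -> L2 X ->
  L2 (E k (fun om => w l i om * X om)).
Proof.
move=> /andP[kl lN] X2; have kN := leq_ltn_trans kl lN.
have wX1 : L1 (fun om => w l i om * X om) by apply: L2M => //; exact: L2_noise.
have wX2 := L2_E_noise i lN X2.
apply: (L2_ae_eq _ (L2_E kN wX2)).
  by apply: (@Fmeas_measurable k) => //; [exact: ltnW|exact: E_Fmeas].
apply: (Fmeas_ceq_ae_eq (ltnW kN)).
- by apply: E_Fmeas => //; exact: L2_L1.
- exact: E_Fmeas.
apply: (ceq_trans (E_ceq kN (L2_L1 wX2))).
apply: (ceq_trans (ceqW kl (E_ceq lN wX1))).
exact: ceq_sym (E_ceq kN wX1).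
Qed.

Lemma noiseZE l i r (X : Omega -> 'cV[R]_r) j :
  (fun om => (w l i om *: X om) j ord0) = (fun om => w l i om * X om j ord0).
Proof. by apply/funext => om; rewrite mxE. Qed.

Lemma l2F_condE_noise k l i r (X : Omega -> 'cV[R]_r) : (k <= l < N)%N ->
  L2v X -> l2F k (condEv k (fun om => w l i om *: X om)).
Proof.
move=> klN X2; apply: l2FI => j; rewrite condEvE noiseZE.
  have /andP[kl lN] := klN.
  apply: E_Fmeas; first exact: leq_ltn_trans lN.
  by apply: L2M => //; exact: L2_noise.
exact: L2_E_noiseW.
Qed.

Lemma l2F_noise l i r (X : Omega -> 'cV[R]_r) : (l < N)%N -> l2F l X ->
  l2F l.+1 (fun om => w l i om *: X om).
Proof.
move=> lN FX; apply: l2FI => j; have [FXj X2] := FX j; rewrite noiseZE.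
  by apply: FmeasM; [exact: Fmeas_noise|exact: FmeasW FXj].
exact: L2_noiseM.
Qed.

(** The common shape of one step of the three forward recursions [stX], [Xstar] and [alpha]. *)
Lemma l2F_step l r (X : Omega -> 'cV[R]_r) (Y : 'I_p -> Omega -> 'cV[R]_r) :
  (l < N)%N -> l2F l X -> (forall i, l2F l (Y i)) ->
  l2F l.+1 (fun om => X om + \sum_(i < p) w l i om *: Y i om).
Proof.
move=> lN FX FY; apply: l2FD; first exact: l2FW FX.
by apply: l2F_sum => i; exact: l2F_noise.
Qed.

Lemma L1_dotv r (X Y : Omega -> 'cV[R]_r) :
  L2v X -> L2v Y -> L1 (fun om => dotv (X om) (Y om)).
Proof.
move=> X2 Y2; under eq_fun do rewrite dotvE.
by apply: L1_sum => i; exact: L2M.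
Qed.

Lemma L1_qf r (X : Omega -> 'cV[R]_r) (M : 'M[R]_r) :
  L2v X -> L1 (fun om => qf (X om) M).
Proof.
by move=> X2; under eq_fun do rewrite qfE; apply: L1_dotv => //; exact: L2vM.
Qed.

Lemma Fmeas_dotv k r (X Y : Omega -> 'cV[R]_r) :
  l2F k X -> l2F k Y -> Fmeas k (fun om => dotv (X om) (Y om)).
Proof.
move=> FX FY; under eq_fun do rewrite dotvE.
by apply: Fmeas_sum => i _; apply: FmeasM; [case: (FX i)|case: (FY i)].
Qed.

Lemma Fmeas_qf k r (X : Omega -> 'cV[R]_r) (M : 'M[R]_r) :
  l2F k X -> Fmeas k (fun om => qf (X om) M).
Proof.
move=> FX; under eq_fun do rewrite qfE.
by apply: Fmeas_dotv => //; exact: l2FM.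
Qed.

(** Componentwise this is [ceqM] at time [l], then coarsened to time [k]. [Y] is not assumed in L2,
    because the lemma must also cover the noise times the adjoint, which is only integrable. *)
Lemma ceq_pull k l r (Y Z : Omega -> 'cV[R]_r) : (k <= l < N)%N ->
  (forall i, L1 (fun om => Y om i ord0)) -> L2v (condEv l Y) ->
  (forall i, L1 (fun om => Y om i ord0 * Z om i ord0)) -> l2F l Z ->
  ceq k (fun om => dotv (condEv l Y om) (Z om)) (fun om => dotv (Y om) (Z om)).
Proof.
move=> /andP[kl lN] Y1 EY2 YZ1 FZ; apply: (ceqW kl).
rewrite (_ : (fun om => dotv (condEv l Y om) _) =
    (fun om => \sum_i Z om i ord0 * condEv l Y om i ord0)); last first.
  by apply/funext => om; rewrite dotvE; apply: eq_bigr => i _; rewrite mulrC.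
rewrite (_ : (fun om => dotv (Y om) _) =
    (fun om => \sum_i Z om i ord0 * Y om i ord0)); last first.
  by apply/funext => om; rewrite dotvE; apply: eq_bigr => i _; rewrite mulrC.
apply: ceq_sum => [|i _]; first exact: Filt_measurable (ltnW lN).
apply: ceqM.
- exact: Filt_measurable (ltnW lN).
- by apply/FmeasP; case: (FZ i).
- by rewrite condEvE; exact: E_ceq.
- by apply: L2M => //; exact: l2F_L2v FZ i.
- have := YZ1 i; congr L1fun.
  by apply/funext => om; rewrite mulrC.
Qed.

Lemma ceq_pull_L2 k l r (Y Z : Omega -> 'cV[R]_r) : (k <= l < N)%N ->
  L2v Y -> l2F l Z ->
  ceq k (fun om => dotv (condEv l Y om) (Z om)) (fun om => dotv (Y om) (Z om)).
Proof.
move=> klN Y2 FZ; have /andP[kl lN] := klN; apply: ceq_pull => //.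
- by move=> i; exact: L2_L1.
- exact: l2F_L2v (l2F_condE lN Y2).
- by move=> i; apply: L2M => //; exact: l2F_L2v FZ i.
Qed.

(** The noise changes sides in the scalar product. While [w l i *: Y] is only integrable,
    [w l i *: Z] is in L2 because [Z] is adapted, and this makes the product with [Y] integrable. *)
Lemma ceq_pull_noise k l j i r (Y Z : Omega -> 'cV[R]_r) :
  (k <= j)%N -> (j <= l < N)%N -> L2v Y -> l2F j Z ->
  ceq k (fun om => dotv (condEv j (fun om => w l i om *: Y om) om) (Z om))
        (fun om => dotv (Y om) (w l i om *: Z om)).
Proof.
move=> kj jlN Y2 FZ; have /andP[jl lN] := jlN.
have wZ2 : L2v (fun om => w l i om *: Z om).
  exact: l2F_L2v (l2F_noise i lN (l2FW jl FZ)).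
rewrite (_ : (fun om => dotv (Y om) _) =
    (fun om => dotv (w l i om *: Y om) (Z om))); last first.
  by apply/funext => om; rewrite dotvZl dotvZr.
apply: ceq_pull => //.
- by rewrite kj (leq_ltn_trans jl).
- by move=> q; rewrite noiseZE; apply: L2M => //; exact: L2_noise.
- exact: l2F_L2v (l2F_condE_noise i jlN Y2).
- move=> q; have := L2M (Y2 q) (wZ2 q); congr L1fun.
  by apply/funext => om; rewrite !mxE mulrCA mulrA.
Qed.

Lemma ae_forall_fin (I : finType) (Q : I -> Omega -> Prop) :
  (forall i, {ae P, forall om, Q i om}) ->
  {ae P, forall om, forall i, Q i om}.
Proof. exact: filter_forall. Qed.

Lemma condEv_ceq k r (X Y : Omega -> 'cV[R]_r) : (k < N)%N -> L2v X ->
  l2F k Y ->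
  (forall i, ceq k (fun om => Y om i ord0) (fun om => X om i ord0)) ->
  {ae P, forall om, condEv k X om = Y om}.
Proof.
move=> kN X2 FY YX.
have : {ae P, forall om, forall i, condEv k X om i ord0 = Y om i ord0}.
  apply: ae_forall_fin => i.
  apply: (Fmeas_ceq_ae_eq (ltnW kN)).
  - by case: (l2F_condE kN X2 i).
  - by case: (FY i).
  - rewrite condEvE; apply: (ceq_trans _ (ceq_sym (YX i))).
    by apply: E_ceq => //; exact: L2_L1.
by apply: filterS => om XY; apply/matrixP => i j; rewrite ord1.
Qed.

Lemma condEv_id k r (X : Omega -> 'cV[R]_r) : (k < N)%N -> l2F k X ->
  {ae P, forall om, condEv k X om = X om}.
Proof.
move=> kN FX; apply: condEv_ceq => //; first exact: l2F_L2v FX.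
by move=> i; apply: ceq_refl; apply: L2_L1; exact: l2F_L2v FX i.
Qed.

(** Linearity of [E k] holds only almost surely. The separate [X'], tied to the linear expression by
    almost sure equality, also yields compatibility of [E k] with changes on null sets. *)
Lemma condEv_lin k r s (M : 'M[R]_(s, r)) (X' Y : Omega -> 'cV[R]_s)
    (X : Omega -> 'cV[R]_r) : (k < N)%N -> L2v X' -> L2v X -> L2v Y ->
  {ae P, forall om, X' om = M *m X om + Y om} ->
  {ae P, forall om, condEv k X' om = M *m condEv k X om + condEv k Y om}.
Proof.
move=> kN X'2 X2 Y2 X'E; have sF := Filt_measurable (ltnW kN).
apply: condEv_ceq => //.
  by apply: l2FD; [apply: l2FM|]; exact: l2F_condE.
move=> i; apply: (@ceq_trans _ _ _ _ _
    (fun om => (\sum_j M i j * X om j ord0) + Y om i ord0)).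
  rewrite (_ : (fun om => _) = (fun om =>
      (\sum_j M i j * condEv k X om j ord0) + condEv k Y om i ord0));
    last first.
    by apply/funext => om; rewrite !mxE.
  apply: ceqD => //; last by rewrite condEvE; apply: E_ceq => //; exact: L2_L1.
  apply: ceq_sum => // j _; apply: ceqZ => //.
  by rewrite condEvE; apply: E_ceq => //; exact: L2_L1.
apply: ceq_sym; apply: ceq_ae => //; first exact: L2_L1.
  apply: measurable_funD; last exact: L2_measurable (Y2 i).
  apply: (@L2_measurable _ _ _ P); apply: L2_sum => j; apply: L2Z.
  exact: X2.
by apply: filterS X'E => om ->; rewrite !mxE.
Qed.

(** * State, adjoint and variation processes *)

Context (n m : nat) (L : LQdata R n m p).
Local Notation stX := (stX w E L).
Local Notation Xstar := (Xstar w L).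
Local Notation alpha := (alpha w E L).
Local Notation Yrev := (Yrev N w E L).

Ltac l2F_tac :=
  repeat first [exact: l2F_cst | assumption | apply: l2FD | apply: l2FM].
Ltac L2v_tac :=
  repeat first [exact: L2v_cst | assumption | apply: L2vD | apply: L2vM].

Definition adm_policy s (ctrl : policy R Omega n m) : Prop :=
  forall l (X : Omega -> 'cV[R]_n), (s <= l < N)%N ->
    l2F l X -> l2F l (ctrl l X).

Lemma stX_start s xi ctrl : stX s xi ctrl s = xi.
Proof. by case: s => //= s; rewrite ltnSn. Qed.

Lemma stXS s xi ctrl k : (s <= k)%N ->
  let X := stX s xi ctrl k in let u := ctrl k X in
  stX s xi ctrl k.+1 = fun om =>
    A_ L s k *m X om + Ab_ L s k *m condEv s X om
    + B_ L s k *m u om + Bb_ L s k *m condEv s u om + f_ L s k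
    + \sum_(i < p) w k i om *:
        (C_ L s k i *m X om + Cb_ L s k i *m condEv s X om
         + D_ L s k i *m u om + Db_ L s k i *m condEv s u om + d_ L s k i).
Proof. by move=> sk /=; rewrite ltnNge sk. Qed.

Lemma stX_l2F s xi ctrl k : l2F s xi -> adm_policy s ctrl -> (s <= k <= N)%N ->
  l2F k (stX s xi ctrl k).
Proof.
move=> Fxi adm; elim: k => [|k IHk] skN.
  by move: skN; rewrite leqn0 => /andP[/eqP s0 _]; rewrite -{1}s0.
have /andP[sk kN] := skN; move: sk; rewrite leq_eqVlt => /predU1P[<-|].
  by rewrite stX_start.
rewrite ltnS => sk; rewrite stXS//.
have {}IHk : l2F k (stX s xi ctrl k) by apply: IHk; rewrite sk ltnW.
have : l2F k (ctrl k (stX s xi ctrl k)) by apply: adm => //; rewrite sk.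
move: (stX s xi ctrl k) IHk => X FX; move: (ctrl k X) => u Fu.
have sN := leq_ltn_trans sk kN.
have FEX : l2F k (condEv s X) by apply: l2FW sk (l2F_condE sN (l2F_L2v FX)).
have FEu : l2F k (condEv s u) by apply: l2FW sk (l2F_condE sN (l2F_L2v Fu)).
by apply: l2F_step => // [|i]; l2F_tac.
Qed.

Lemma Xstar_start t x Phi v : Xstar t x Phi v t = x.
Proof. by case: t => //= t; rewrite ltnSn. Qed.

Lemma XstarS t x Phi v k : (t <= k)%N -> let X := Xstar t x Phi v k in
  Xstar t x Phi v k.+1 = fun om =>
    (A_ L k k + Ab_ L k k + (B_ L k k + Bb_ L k k) *m Phi k) *m X om
    + (B_ L k k + Bb_ L k k) *m v k om + f_ L k k
    + \sum_(i < p) w k i om *: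
        ((C_ L k k i + Cb_ L k k i
          + (D_ L k k i + Db_ L k k i) *m Phi k) *m X om
         + (D_ L k k i + Db_ L k k i) *m v k om + d_ L k k i).
Proof. by move=> tk /=; rewrite ltnNge tk. Qed.

Lemma Xstar_l2F t x Phi v k : l2F t x ->
  (forall l, (t <= l < N)%N -> l2F l (v l)) -> (t <= k <= N)%N ->
  l2F k (Xstar t x Phi v k).
Proof.
move=> Fx Fv; elim: k => [|k IHk] tkN.
  by move: tkN; rewrite leqn0 => /andP[/eqP t0 _]; rewrite -{1}t0.
have /andP[tk kN] := tkN; move: tk; rewrite leq_eqVlt => /predU1P[<-|].
  by rewrite Xstar_start.
rewrite ltnS => tk; rewrite XstarS//.
have {}IHk : l2F k (Xstar t x Phi v k) by apply: IHk; rewrite tk ltnW.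
have Fvk : l2F k (v k) by apply: Fv; rewrite tk.
move: (Xstar t x Phi v k) IHk => X FX.
by apply: l2F_step => // [|i]; l2F_tac.
Qed.

Lemma alpha_start k Phi ub : alpha k Phi ub k = fun=> 0.
Proof. by case: k => //= k; rewrite ltnSn. Qed.

Lemma alpha_first k Phi ub : alpha k Phi ub k.+1 = fun om =>
  (B_ L k k + Bb_ L k k) *m ub om
  + \sum_(i < p) w k i om *: ((D_ L k k i + Db_ L k k i) *m ub om).
Proof. by rewrite /= ltnn eqxx. Qed.

Lemma alphaS k Phi ub l : (k < l)%N -> let a := alpha k Phi ub l in
  alpha k Phi ub l.+1 = fun om =>
    (A_ L k l + B_ L k l *m Phi l) *m a om
    + (Ab_ L k l + Bb_ L k l *m Phi l) *m condEv k a om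
    + \sum_(i < p) w l i om *:
        ((C_ L k l i + D_ L k l i *m Phi l) *m a om
         + (Cb_ L k l i + Db_ L k l i *m Phi l) *m condEv k a om).
Proof. by move=> kl /=; rewrite ltnNge ltnW//= gtn_eqF. Qed.

Lemma alpha_l2F k Phi ub l : l2F k ub -> (k <= l <= N)%N ->
  l2F l (alpha k Phi ub l).
Proof.
move=> Fub; elim: l => [|l IHl] klN; first exact: l2F_cst.
have /andP[kl lN] := klN; move: kl; rewrite leq_eqVlt => /predU1P[<-|].
  by rewrite alpha_start; exact: l2F_cst.
rewrite ltnS leq_eqVlt => /predU1P[kl|kl].
  rewrite -kl in lN *; rewrite alpha_first.
  by apply: l2F_step => // [|i]; l2F_tac.
rewrite alphaS//.
have {}IHl : l2F l (alpha k Phi ub l) by apply: IHl; rewrite ltnW//= ltnW.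
move: (alpha k Phi ub l) IHl => a Fa.
have FEa : l2F l (condEv k a).
  by apply: l2FW (ltnW kl) (l2F_condE (ltn_trans kl lN) (l2F_L2v Fa)).
by apply: l2F_step => // [|i]; l2F_tac.
Qed.

(** [Yrev] counts steps back from [N]; for [l < N] the truncated subtractions cancel and the
    recursion is recovered in the time index. *)
Lemma YrevS k Phi v (X : nat -> Omega -> 'cV[R]_n) xk l : (l < N)%N ->
  let Y := Yrev k Phi v X xk (N - l.+1) in
  Yrev k Phi v X xk (N - l) = fun om =>
    (Q_ L k l + (Phi l)^T *m R_ L k l *m Phi l) *m X l om
  + (Qb_ L k l + (Phi l)^T *m Rb_ L k l *m Phi l) *m condEv k (X l) om
  + (Phi l)^T *m R_ L k l *m v l om
  + (Phi l)^T *m Rb_ L k l *m condEv k (v l) om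
  + (A_ L k l + B_ L k l *m Phi l)^T *m condEv l Y om
  + (Ab_ L k l + Bb_ L k l *m Phi l)^T *m condEv k Y om
  + \sum_(i < p)
      ((C_ L k l i + D_ L k l i *m Phi l)^T
          *m condEv l (fun om' => w l i om' *: Y om') om
     + (Cb_ L k l i + Db_ L k l i *m Phi l)^T
          *m condEv k (fun om' => w l i om' *: Y om') om)
  + (Phi l)^T *m rho_ L k l + q_ L k l.
Proof.
move=> lN /=; have -> : (N - l = (N - l.+1).+1)%N by rewrite subnSK.
by rewrite /= (subnSK lN) subKn// ltnW.
Qed.

Lemma Yrev_L2v k Phi v (X : nat -> Omega -> 'cV[R]_n) xk j : (k < N)%N ->
  (forall l, (k <= l < N)%N -> L2v (v l)) ->
  (forall l, (k <= l <= N)%N -> L2v (X l)) -> L2v xk ->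
  (j + k <= N)%N -> L2v (Yrev k Phi v X xk j).
Proof.
move=> kN v2 X2 xk2; elim: j => [_|j IHj jkN] /=.
  have XN2 : L2v (X N) by apply: X2; rewrite leqnn ltnW.
  have EXN2 := l2F_L2v (l2F_condE kN XN2).
  by L2v_tac.
have Y2 : L2v (Yrev k Phi v X xk j) by apply: IHj; exact: ltnW.
move: (Yrev k Phi v X xk j) Y2 => Y Y2.
have jN : (j < N)%N by apply: leq_trans jkN; rewrite leq_addr.
set l := (N - j.+1)%N.
have kl : (k <= l)%N by rewrite /l leq_subRL// addnC.
have lN : (l < N)%N by rewrite /l ltn_subrL (leq_ltn_trans _ jN).
have klN : (k <= l < N)%N by rewrite kl.
have Xl2 : L2v (X l) by apply: X2; rewrite kl ltnW.
have vl2 : L2v (v l) by exact: v2.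
have EXl2 := l2F_L2v (l2F_condE kN Xl2).
have Evl2 := l2F_L2v (l2F_condE kN vl2).
have ElY2 := l2F_L2v (l2F_condE lN Y2).
have EkY2 := l2F_L2v (l2F_condE kN Y2).
have ElwY2 i : L2v (condEv l (fun om => w l i om *: Y om)).
  by apply: (@l2F_L2v l); apply: l2F_condE_noise => //; rewrite leqnn.
have EkwY2 i : L2v (condEv k (fun om => w l i om *: Y om)).
  by apply: (@l2F_L2v k); apply: l2F_condE_noise.
do 2 (apply: L2vD; last exact: L2v_cst).
apply: L2vD; first by L2v_tac.
by apply: L2v_sum => i; apply: L2vD; apply: L2vM.
Qed.

Lemma condEv_add k r (X' X Y : Omega -> 'cV[R]_r) : (k < N)%N ->
  L2v X' -> L2v X -> L2v Y -> {ae P, forall om, X' om = X om + Y om} ->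
  {ae P, forall om, condEv k X' om = condEv k X om + condEv k Y om}.
Proof.
move=> kN X'2 X2 Y2 X'E.
have := @condEv_lin k _ _ 1%:M X' Y X kN X'2 X2 Y2; move=> /(_ _)/wrap[].
  by apply: filterS X'E => om ->; rewrite mul1mx.
by apply: filterS => om ->; rewrite mul1mx.
Qed.

Lemma condEv_mulmx k r s (M : 'M[R]_(s, r)) (X' : Omega -> 'cV[R]_s)
    (X : Omega -> 'cV[R]_r) : (k < N)%N -> L2v X' -> L2v X ->
  {ae P, forall om, X' om = M *m X om} ->
  {ae P, forall om, condEv k X' om = M *m condEv k X om}.
Proof.
move=> kN X'2 X2 X'E.
have E0 := condEv_id kN (@l2F_cst k s 0).
have := @condEv_lin k _ _ M X' (fun=> 0) X kN X'2 X2 (L2v_cst 0).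
move=> /(_ _)/wrap[]; first by apply: filterS X'E => om ->; rewrite addr0.
move=> EX'; apply: (aeS2 EX' E0) => om -> ->.
by rewrite addr0.
Qed.

(** The dynamics are affine: the free terms [f] and [d] stay with the reference state, and the
    perturbation follows the linear part. *)
Lemma state_dyn_add (A Ab : 'M[R]_n) (B Bb : 'M[R]_(n, m)) (f : 'cV[R]_n)
    (C Cb : 'I_p -> 'M[R]_n) (D Db : 'I_p -> 'M[R]_(n, m))
    (d : 'I_p -> 'cV[R]_n) (c : 'I_p -> R)
    (x ex a ea : 'cV[R]_n) (u eu b eb : 'cV[R]_m) :
  A *m (x + a) + Ab *m (ex + ea) + B *m (u + b) + Bb *m (eu + eb) + f
  + \sum_i c i *: (C i *m (x + a) + Cb i *m (ex + ea) + D i *m (u + b)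
                   + Db i *m (eu + eb) + d i) =
  (A *m x + Ab *m ex + B *m u + Bb *m eu + f
   + \sum_i c i *: (C i *m x + Cb i *m ex + D i *m u + Db i *m eu + d i))
  + (A *m a + Ab *m ea + B *m b + Bb *m eb
     + \sum_i c i *: (C i *m a + Cb i *m ea + D i *m b + Db i *m eb)).
Proof.
under eq_bigr => i _.
  rewrite !mulmxDr (AC (2*2*2*2*1) ((1*3*5*7*9)*(2*4*6*8))) scalerDr.
  over.
by rewrite big_split/= !mulmxDr
  (AC (2*2*2*2*1*2) ((1*3*5*7*9*10)*(2*4*6*8*11))).
Qed.

(** Rewrites closed-loop coefficients as open-loop ones driven by the control [K *m x]. *)
Lemma feedback_dyn (A Ab : 'M[R]_n) (B Bb : 'M[R]_(n, m)) (K : 'M[R]_(m, n))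
    (x ex : 'cV[R]_n) :
  (A + B *m K) *m x + (Ab + Bb *m K) *m ex =
  A *m x + Ab *m ex + B *m (K *m x) + Bb *m (K *m ex).
Proof. by rewrite !mulmxDl !mulmxA (AC (2*2) (1*3*2*4)). Qed.

(** Pairs one backward step of Y with a state variation [a]. The running cost contributes its state
    gradient against [a] and its control gradient against the induced variation [K *m a]; [y], [z],
    [s] stand for the transposed dynamics. *)
Lemma adjoint_dyn (Q Qb : 'M[R]_n) (W Wb : 'M[R]_m) (K : 'M[R]_(m, n))
    (x ex y z s q a : 'cV[R]_n) (b eb rho : 'cV[R]_m) :
  dotv ((Q + K^T *m W *m K) *m x + (Qb + K^T *m Wb *m K) *m ex
        + K^T *m W *m b + K^T *m Wb *m eb + y + z + s + K^T *m rho + q) a =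
  dotv (Q *m x + Qb *m ex + q) a
  + dotv (W *m (K *m x + b) + Wb *m (K *m ex + eb) + rho) (K *m a)
  + dotv y a + dotv z a + dotv s a.
Proof.
by rewrite dotv_mulmxr !mulmxDr !mulmxDl !mulmxA !dotvDl; ring.
Qed.

Lemma adm_fb s Phi v : (forall l, (s <= l < N)%N -> l2F l (v l)) ->
  adm_policy s (fb Phi v).
Proof.
by move=> Fv l X slN FX; rewrite /fb; have Fvl := Fv l slN; l2F_tac.
Qed.

Lemma adm_mixpol s u Phi v : (forall l, (s <= l < N)%N -> l2F l (v l)) ->
  l2F s u -> adm_policy s (mixpol s u Phi v).
Proof.
move=> Fv Fu l X slN FX; rewrite /mixpol; case: eqP => [->//|_].
exact: (adm_fb Phi Fv slN FX).
Qed.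

Ltac L1_tac := repeat first [assumption | apply: L1D | apply: L1Z
  | apply: L1_dotv | apply: L1_qf | apply: L2v_cst | apply: L2vD | apply: L2vM].

Lemma ceq_pull_dual k r (Z X : Omega -> 'cV[R]_r) : (k < N)%N ->
  l2F k Z -> L2v X ->
  ceq k (fun om => dotv (Z om) (condEv k X om)) (fun om => dotv (Z om) (X om)).
Proof.
move=> kN FZ X2; have := @ceq_pull_L2 k k _ X Z; rewrite leqnn kN.
move=> /(_ isT X2 FZ); congr (cond_eq _ _); apply/funext => om; exact: dotvC.
Qed.

Lemma ceq_pull_mx k r s (M : 'M[R]_(s, r)) (Z : Omega -> 'cV[R]_s)
    (X : Omega -> 'cV[R]_r) : (k < N)%N -> l2F k Z -> L2v X ->
  ceq k (fun om => dotv (Z om) (M *m X om))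
        (fun om => dotv (Z om) (M *m condEv k X om)).
Proof.
move=> kN FZ X2; apply: ceq_sym.
have := ceq_pull_dual kN (l2FM M^T FZ) X2.
by congr (cond_eq _ _); apply/funext => om; rewrite dotv_mulmxl trmxK.
Qed.

(** The integrand of one summand of [Jcost]. The outer [E s] disappears modulo [ceq s], whereas the
    inner expectations enter quadratically and must stay. *)
Definition run_cost s xi ctrl l om : R :=
  qf (stX s xi ctrl l om) (Q_ L s l)
  + qf (condEv s (stX s xi ctrl l) om) (Qb_ L s l)
  + qf (ctrl l (stX s xi ctrl l) om) (R_ L s l)
  + qf (condEv s (ctrl l (stX s xi ctrl l)) om) (Rb_ L s l)
  + 2 * dotv (q_ L s l) (stX s xi ctrl l om)
  + 2 * dotv (rho_ L s l) (ctrl l (stX s xi ctrl l) om).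

Definition end_cost s xi ctrl om : R :=
  qf (stX s xi ctrl N om) (G_ L s)
  + qf (condEv s (stX s xi ctrl N) om) (Gb_ L s)
  + 2 * dotv (F_ L s *m xi om + g_ L s) (condEv s (stX s xi ctrl N) om).

Lemma L1_run_cost s xi ctrl l : l2F s xi -> adm_policy s ctrl ->
  (s <= l < N)%N -> L1 (run_cost s xi ctrl l).
Proof.
move=> Fxi adm slN; have /andP[sl lN] := slN; rewrite /run_cost.
have FX : l2F l (stX s xi ctrl l) by apply: stX_l2F; rewrite // sl ltnW.
have Fu := adm _ _ slN FX.
move: (stX s xi ctrl l) FX Fu => X FX; move: (ctrl l X) => u Fu.
have sN := leq_ltn_trans sl lN.
have X2 := l2F_L2v FX; have u2 := l2F_L2v Fu.
have EX2 := l2F_L2v (l2F_condE sN X2); have Eu2 := l2F_L2v (l2F_condE sN u2).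
by L1_tac.
Qed.

Lemma Jcost_ceq s xi ctrl : (s < N)%N -> l2F s xi -> adm_policy s ctrl ->
  ceq s (Jcost N w E L s xi ctrl) (fun om =>
    \sum_(s <= l < N) run_cost s xi ctrl l om + end_cost s xi ctrl om).
Proof.
move=> sN Fxi adm; have sF := Filt_measurable (ltnW sN).
have FX : l2F N (stX s xi ctrl N) by apply: stX_l2F => //; rewrite leqnn ltnW.
have X2 := l2F_L2v FX; have EX2 := l2F_L2v (l2F_condE sN X2).
have xi2 := l2F_L2v Fxi.
have H : ceq s (fun om => \sum_(s <= l < N) E s (run_cost s xi ctrl l) om)
    (fun om => \sum_(s <= l < N) run_cost s xi ctrl l om).
  by apply: ceq_sum_nat => // l slN; apply: E_ceq => //; exact: L1_run_cost.
have := ceqD sF (ceqD sF (ceqD sF H (E_ceq sN (L1_qf (G_ L s) X2)))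
  (ceq_refl (Fgen s) (L1_qf (Gb_ L s) EX2)))
  (ceq_refl (Fgen s) (_ : L1 (fun om =>
     2 * dotv (F_ L s *m xi om + g_ L s) (condEv s (stX s xi ctrl N) om)))).
move=> /(_ _)/wrap[]; first by L1_tac.
congr (cond_eq _ _); apply/funext => om.
by rewrite /end_cost !addrA.
Qed.

Lemma Jcost_Fmeas s xi ctrl : (s < N)%N -> l2F s xi -> adm_policy s ctrl ->
  Fmeas s (Jcost N w E L s xi ctrl).
Proof.
move=> sN Fxi adm.
have FX : l2F N (stX s xi ctrl N) by apply: stX_l2F => //; rewrite leqnn ltnW.
have X2 := l2F_L2v FX; have FEX := l2F_condE sN X2.
apply: FmeasD; last first.
  by apply: FmeasZ; apply: Fmeas_dotv => //; l2F_tac.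
apply: FmeasD; last exact: Fmeas_qf.
apply: FmeasD; last by apply: E_Fmeas => //; exact: L1_qf.
apply: Fmeas_sum => l; rewrite mem_index_iota => slN.
by apply: E_Fmeas => //; exact: L1_run_cost.
Qed.

(** The right-hand side of the stationarity condition, for an arbitrary initial state [xi] instead
    of the equilibrium state. *)
Definition stationarity k Phi v xi om : 'cV[R]_m :=
  let X := stX k xi (fb Phi v) in let Y := Yrev k Phi v X xi (N - k.+1) in
  (R_ L k k + Rb_ L k k) *m (Phi k *m X k om + v k om)
  + (B_ L k k + Bb_ L k k)^T *m condEv k Y om
  + \sum_(i < p) (D_ L k k i + Db_ L k k i)^T
       *m condEv k (fun om' => w k i om' *: Y om') om
  + rho_ L k k.

Definition var_run k Phi ub l om : R :=
  qf (alpha k Phi ub l om) (Q_ L k l + (Phi l)^T *m R_ L k l *m Phi l)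
  + qf (condEv k (alpha k Phi ub l) om)
       (Qb_ L k l + (Phi l)^T *m Rb_ L k l *m Phi l).

Definition var_end k Phi ub om : R :=
  qf (alpha k Phi ub N om) (G_ L k)
  + qf (condEv k (alpha k Phi ub N) om) (Gb_ L k).

Lemma L1_var_run k Phi ub l : l2F k ub -> (k <= l < N)%N ->
  L1 (var_run k Phi ub l).
Proof.
move=> Fub /andP[kl lN]; have kN := leq_ltn_trans kl lN; rewrite /var_run.
have Fa : l2F l (alpha k Phi ub l) by apply: alpha_l2F; rewrite // kl ltnW.
have a2 := l2F_L2v Fa; have Ea2 := l2F_L2v (l2F_condE kN a2).
by L1_tac.
Qed.

Lemma Jtilde_ceq k Phi ub : (k < N)%N -> l2F k ub ->
  ceq k (Jtilde N w E L k Phi ub) (fun om =>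
    \sum_(k <= l < N) var_run k Phi ub l om
    + qf (ub om) (R_ L k k + Rb_ L k k) + var_end k Phi ub om).
Proof.
move=> kN Fub; have sF := Filt_measurable (ltnW kN).
have Fa : l2F N (alpha k Phi ub N).
  by apply: alpha_l2F => //; rewrite leqnn ltnW.
have a2 := l2F_L2v Fa; have Ea2 := l2F_L2v (l2F_condE kN a2).
have ub2 := l2F_L2v Fub.
have H : ceq k (fun om => \sum_(k <= l < N) E k (var_run k Phi ub l) om)
    (fun om => \sum_(k <= l < N) var_run k Phi ub l om).
  by apply: ceq_sum_nat => // l klN; apply: E_ceq => //; exact: L1_var_run.
have := ceqD sF (ceqD sF (ceqD sF H
    (E_ceq kN (L1_qf (R_ L k k + Rb_ L k k) ub2)))
    (E_ceq kN (L1_qf (G_ L k) a2)))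
  (ceq_refl (Fgen k) (L1_qf (Gb_ L k) Ea2)).
congr (cond_eq _ _); apply/funext => om.
by rewrite /var_end !addrA.
Qed.

Lemma Jtilde_Fmeas k Phi ub : (k < N)%N -> l2F k ub ->
  Fmeas k (Jtilde N w E L k Phi ub).
Proof.
move=> kN Fub.
have Fa : l2F N (alpha k Phi ub N).
  by apply: alpha_l2F => //; rewrite leqnn ltnW.
have a2 := l2F_L2v Fa; have FEa := l2F_condE kN a2.
apply: FmeasD; last exact: Fmeas_qf.
apply: FmeasD; last by apply: E_Fmeas => //; exact: L1_qf.
apply: FmeasD; last by apply: E_Fmeas => //; apply: L1_qf; exact: l2F_L2v Fub.
apply: Fmeas_sum => l; rewrite mem_index_iota => klN.
by apply: E_Fmeas => //; exact: L1_var_run.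
Qed.

(** * Expansion of the perturbed cost *)

Section Perturbation.
Context (k : nat) (Phi : nat -> 'M[R]_(m, n)) (v : nat -> Omega -> 'cV[R]_m).
Context (xi : Omega -> 'cV[R]_n) (u : Omega -> 'cV[R]_m).
Hypothesis kN : (k < N)%N.
Hypothesis Fxi : l2F k xi.
Hypothesis Fv : forall l, (k <= l < N)%N -> l2F l (v l).
Hypothesis Fu : l2F k u.

Let X := stX k xi (fb Phi v).
Let U l := fb Phi v l (X l).
Let X' := stX k xi (mixpol k u Phi v).
Let U' l := mixpol k u Phi v l (X' l).
Let ub om := u om - (Phi k *m xi om + v k om).
Let a := alpha k Phi ub.
(** The variation of the control: the free deviation [ub] at time [k], then the response of the
    feedback to the state variation. *)
Let du l := if l == k then ub else fun om => Phi l *m a l om.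
Let Y l := Yrev k Phi v X xi (N - l).

Let FX l : (k <= l <= N)%N -> l2F l (X l).
Proof. by move=> klN; apply: stX_l2F => //; exact: adm_fb. Qed.

Let FX' l : (k <= l <= N)%N -> l2F l (X' l).
Proof. by move=> klN; apply: stX_l2F => //; exact: adm_mixpol. Qed.

Let FU l : (k <= l < N)%N -> l2F l (U l).
Proof.
move=> /andP[kl lN]; apply: (adm_fb _ Fv); first by rewrite kl.
by apply: FX; rewrite kl ltnW.
Qed.

Let FU' l : (k <= l < N)%N -> l2F l (U' l).
Proof.
move=> /andP[kl lN]; apply: (adm_mixpol _ Fv Fu); first by rewrite kl.
by apply: FX'; rewrite kl ltnW.
Qed.

Let Fub : l2F k ub.
Proof.
have Fvk : l2F k (v k) by apply: Fv; rewrite leqnn.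
by apply: l2FB => //; l2F_tac.
Qed.

Let Fa l : (k <= l <= N)%N -> l2F l (a l).
Proof. exact: alpha_l2F. Qed.

Let Fdu l : (k <= l < N)%N -> l2F l (du l).
Proof.
move=> /andP[kl lN]; rewrite /du; case: eqP => [->//|_].
by apply: l2FM; apply: Fa; rewrite kl ltnW.
Qed.

Let X2 l : (k <= l <= N)%N -> L2v (X l).
Proof. by move/FX/l2F_L2v. Qed.

Let X'2 l : (k <= l <= N)%N -> L2v (X' l).
Proof. by move/FX'/l2F_L2v. Qed.

Let U2 l : (k <= l < N)%N -> L2v (U l).
Proof. by move/FU/l2F_L2v. Qed.

Let U'2 l : (k <= l < N)%N -> L2v (U' l).
Proof. by move/FU'/l2F_L2v. Qed.

Let a2 l : (k <= l <= N)%N -> L2v (a l).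
Proof. by move/Fa/l2F_L2v. Qed.

Let du2 l : (k <= l < N)%N -> L2v (du l).
Proof. by move/Fdu/l2F_L2v. Qed.

Let Y2 l : (k <= l <= N)%N -> L2v (Y l).
Proof.
move=> /andP[kl lN]; apply: Yrev_L2v => //.
- by move=> j /Fv/l2F_L2v.
- exact: l2F_L2v Fxi.
- by rewrite -leq_subRL ?subKn// leq_subr.
Qed.

Let ltW l : (k <= l < N)%N -> (k <= l <= N)%N.
Proof. by move=> /andP[-> /ltnW]. Qed.

Let condEv_fb l : (k <= l < N)%N -> {ae P, forall om,
  condEv k (U l) om = Phi l *m condEv k (X l) om + condEv k (v l) om}.
Proof.
move=> klN; apply: condEv_lin => //.
- exact: U2.
- by apply: X2; exact: ltW.
- exact: l2F_L2v (Fv klN).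
- exact: aeW.
Qed.

Let condEv_du l : (k <= l < N)%N -> {ae P, forall om, condEv k (du l) om =
  if l == k then ub om else Phi l *m condEv k (a l) om}.
Proof.
move=> klN; have := du2 klN; rewrite /du; case: eqP => [_ _|_ dul2].
  exact: condEv_id.
apply: condEv_mulmx => //; last exact: aeW.
by apply: a2; exact: ltW.
Qed.

(** Unifies the two cases in the definition of [alpha] as an open-loop recursion driven by [du]. It
    also holds at [l = k], because the variation starts at 0 and [ub] is F_k-measurable; there it is
    only almost sure, as [E k] enters. *)
Let alpha_dyn l : (k <= l < N)%N -> {ae P, forall om, a l.+1 om =
  A_ L k l *m a l om + Ab_ L k l *m condEv k (a l) om
  + B_ L k l *m du l om + Bb_ L k l *m condEv k (du l) om
  + \sum_(i < p) w l i om *: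
      (C_ L k l i *m a l om + Cb_ L k l i *m condEv k (a l) om
       + D_ L k l i *m du l om + Db_ L k l i *m condEv k (du l) om)}.
Proof.
move=> klN; have Edu := condEv_du klN; have /andP[kl lN] := klN.
move: kl; rewrite leq_eqVlt => /predU1P[kl|kl].
  rewrite -kl eqxx in Edu *.
  have E0 := condEv_id kN (@l2F_cst k n 0).
  apply: (aeS2 Edu E0) => om; rewrite /a alpha_first alpha_start => -> ->.
  rewrite /du eqxx !mulmx0 !add0r mulmxDl; congr (_ + _).
  by apply: eq_bigr => i _; rewrite !mulmx0 !add0r mulmxDl.
apply: filterS Edu => om; rewrite /a alphaS// gtn_eqF// => ->.
rewrite /du gtn_eqF// feedback_dyn; congr (_ + _).
by apply: eq_bigr => i _; rewrite feedback_dyn.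
Qed.

Let policy_split l : (k <= l < N)%N ->
  {ae P, forall om, X' l om = X l om + a l om} ->
  {ae P, forall om, U' l om = U l om + du l om}.
Proof.
move=> klN; apply: filterS => om; rewrite /U' /U /mixpol /du.
case: eqP => [-> _|_]; last by rewrite /fb => ->; rewrite mulmxDr addrAC.
by rewrite /X stX_start /ub /fb addrC subrK.
Qed.

(** At each step the splitting of the state gives that of the control, then those of both
    conditional expectations, and these four together give the next state. *)
Let state_split l : (k <= l <= N)%N ->
  {ae P, forall om, X' l om = X l om + a l om}.
Proof.
elim: l => [|l IHl] klN.
  by apply: aeW => om; rewrite /X /X' /a /= addr0.
have /andP[kl lN] := klN; move: kl; rewrite leq_eqVlt => /predU1P[kl|].
  by apply: aeW => om; rewrite /X /X' /a -kl !stX_start alpha_start addr0.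
rewrite ltnS => kl; have klN' : (k <= l < N)%N by rewrite kl.
have klN'' := ltW klN'.
have {}IHl := IHl klN''; have IHu := policy_split klN' IHl.
have EX := condEv_add kN (X'2 klN'') (X2 klN'') (a2 klN'') IHl.
have EU := condEv_add kN (U'2 klN') (U2 klN') (du2 klN') IHu.
have H1 := aeS2 IHl IHu (fun _ h1 h2 => conj h1 h2).
have H2 := aeS2 EX EU (fun _ h1 h2 => conj h1 h2).
have H3 := aeS2 H2 (alpha_dyn klN') (fun _ h1 h2 => conj h1 h2).
apply: (aeS2 H1 H3) => om [h1 h2] [[h3 h4] ->].
rewrite /X' /X !stXS// -/X' -/X -/(U' l) -/(U l) h1 h2 h3 h4.
exact: state_dyn_add.
Qed.

(* [lam] is half the first variation of the running cost, with the conditional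
   expectations of the variations already removed. *)
Let lam l om : R :=
  dotv (Q_ L k l *m X l om + Qb_ L k l *m condEv k (X l) om + q_ L k l) (a l om)
  + dotv (R_ L k l *m U l om + Rb_ L k l *m condEv k (U l) om + rho_ L k l)
         (du l om).

(** Written with [du], so that at [l = k] it contains the control weight of [ub], which [Jtilde]
    lists as a separate term. *)
Let quad l om : R :=
  qf (a l om) (Q_ L k l) + qf (condEv k (a l) om) (Qb_ L k l)
  + qf (du l om) (R_ L k l) + qf (condEv k (du l) om) (Rb_ L k l).

Let S := stationarity k Phi v xi.

Hypothesis Hsym : LQsym N L.

Let sF : Filt k `<=` measurable.
Proof. exact: Filt_measurable (ltnW kN). Qed.

Let EX2 l : (k <= l <= N)%N -> L2v (condEv k (X l)).
Proof. by move=> /X2 X2l; exact: l2F_L2v (l2F_condE kN X2l). Qed.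

Let Ea2 l : (k <= l <= N)%N -> L2v (condEv k (a l)).
Proof. by move=> /a2 a2l; exact: l2F_L2v (l2F_condE kN a2l). Qed.

Let EU2 l : (k <= l < N)%N -> L2v (condEv k (U l)).
Proof. by move=> /U2 U2l; exact: l2F_L2v (l2F_condE kN U2l). Qed.

Let Edu2 l : (k <= l < N)%N -> L2v (condEv k (du l)).
Proof. by move=> /du2 du2l; exact: l2F_L2v (l2F_condE kN du2l). Qed.

Let lam1 l : (k <= l < N)%N -> L1 (lam l).
Proof.
move=> klN; have klN' := ltW klN; rewrite /lam.
have := X2 klN'; have := EX2 klN'; have := a2 klN'.
have := U2 klN; have := EU2 klN; have := du2 klN.
by move=> ? ? ? ? ? ?; L1_tac.
Qed.

Let quad1 l : (k <= l < N)%N -> L1 (quad l).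
Proof.
move=> klN; have klN' := ltW klN; rewrite /quad.
have := a2 klN'; have := Ea2 klN'; have := du2 klN; have := Edu2 klN.
by move=> ? ? ? ?; L1_tac.
Qed.

(** Symmetry of the weights gives the exact second-order expansion. The cross terms of [Qb_] and
    [Rb_] contain conditional expectations of the variations; these are removed ([c1], [c2]) because
    the other factor is F_k-measurable. *)
Let run_split l : (k <= l < N)%N ->
  ceq k (run_cost k xi (mixpol k u Phi v) l)
    (fun om => run_cost k xi (fb Phi v) l om + 2 * lam l om + quad l om).
Proof.
move=> klN; have klN' := ltW klN.
have run1 := L1_run_cost Fxi (adm_fb Phi Fv) klN.
have run'1 := L1_run_cost Fxi (adm_mixpol Phi Fv Fu) klN.
have X2l := X2 klN'; have EX2l := EX2 klN'; have a2l := a2 klN'.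
have U2l := U2 klN; have EU2l := EU2 klN; have du2l := du2 klN.
have Ea2l := Ea2 klN'; have Edu2l := Edu2 klN; have quad1l := quad1 klN.
have XE := state_split klN'; have UE := policy_split klN XE.
have EXE := condEv_add kN (X'2 klN') X2l a2l XE.
have EUE := condEv_add kN (U'2 klN) U2l du2l UE.
have e1 : L1 (fun om => dotv (Q_ L k l *m X l om + q_ L k l) (a l om)).
  by L1_tac.
have e2 : L1 (fun om => dotv (R_ L k l *m U l om + rho_ L k l) (du l om)).
  by L1_tac.
have c1 := ceq_pull_dual kN (l2FM (Qb_ L k l) (l2F_condE kN X2l)) a2l.
have c2 := ceq_pull_dual kN (l2FM (Rb_ L k l) (l2F_condE kN U2l)) du2l.
have c3 := ceqD sF (ceqD sF (ceq_refl (Fgen k) run1)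
  (ceqZ sF 2 (ceqD sF (ceqD sF (ceqD sF (ceq_refl (Fgen k) e1) c1)
    (ceq_refl (Fgen k) e2)) c2))) (ceq_refl (Fgen k) quad1l).
have [mid1 _ _] := c3.
apply: ceq_trans (ceq_trans c3 _).
  apply: ceq_ae => //; first exact: L1_measurable mid1.
  have [Hs _] := Hsym; have [Qs [Qbs [Rs Rbs]]] := Hs k l klN.
  have H1 := aeS2 XE UE (fun _ h1 h2 => conj h1 h2).
  have H2 := aeS2 EXE EUE (fun _ h1 h2 => conj h1 h2).
  apply: (aeS2 H1 H2) => om [h1 h2] [h3 h4].
  rewrite /run_cost -/X' -/X -/(U' l) -/(U l) h1 h2 h3 h4 /quad !qfD//.
  by rewrite !dotvDl !dotvDr; ring.
have [_ mid2 _] := c3.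
have -> : (fun om => run_cost k xi (fb Phi v) l om + 2 * lam l om + quad l om) =
   (fun om => run_cost k xi (fb Phi v) l om +
    2 * (dotv (Q_ L k l *m X l om + q_ L k l) (a l om)
     + dotv (Qb_ L k l *m condEv k (X l) om) (a l om)
     + dotv (R_ L k l *m U l om + rho_ L k l) (du l om)
     + dotv (Rb_ L k l *m condEv k (U l) om) (du l om)) + quad l om).
  by apply/funext => om; rewrite /lam !dotvDl; ring.
exact: ceq_refl.
Qed.

(** The same expansion for the terminal cost; half its gradient, including the term in
    [F_ L k *m xi + g_ L k], is the terminal value of Y. *)
Let end_split : ceq k (end_cost k xi (mixpol k u Phi v))
  (fun om => end_cost k xi (fb Phi v) om + 2 * dotv (Y N om) (a N om)
             + var_end k Phi ub om).
Proof.
have kNN : (k <= N <= N)%N by rewrite leqnn ltnW.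
have X2N := X2 kNN; have EX2N := EX2 kNN; have a2N := a2 kNN.
have Ea2N := Ea2 kNN; have X'2N := X'2 kNN; have xi2 := l2F_L2v Fxi.
have XE := state_split kNN; have EXE := condEv_add kN X'2N X2N a2N XE.
have F2 : L2v (fun om => F_ L k *m xi om + g_ L k) by L2v_tac.
have end1' : forall ctrl, L2v (stX k xi ctrl N) -> L1 (end_cost k xi ctrl).
  rewrite /end_cost => ctrl; move: (stX k xi ctrl N) => Z Z2.
  have EZ2 := l2F_L2v (l2F_condE kN Z2).
  by apply: L1D; [apply: L1D; exact: L1_qf|apply: L1Z; exact: L1_dotv].
have end1 := end1' _ X2N; have end'1 := end1' _ X'2N.
have var1 : L1 (var_end k Phi ub) by rewrite /var_end -/a; L1_tac.
have e1 : L1 (fun om => dotv (G_ L k *m X N om) (a N om)) by L1_tac.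
have c1 := ceq_pull_dual kN (l2FM (Gb_ L k) (l2F_condE kN X2N)) a2N.
have c2 := ceq_pull_dual kN (l2FD (l2FM (F_ L k) Fxi) (l2F_cst k (g_ L k))) a2N.
have c3 := ceqD sF (ceqD sF (ceq_refl (Fgen k) end1)
  (ceqZ sF 2 (ceqD sF (ceqD sF (ceq_refl (Fgen k) e1) c1) c2)))
  (ceq_refl (Fgen k) var1).
have [mid1 mid2 _] := c3.
apply: ceq_trans (ceq_trans c3 _).
  apply: ceq_ae => //; first exact: L1_measurable mid1.
  have [_ /(_ k kN)[Gs Gbs]] := Hsym.
  apply: (aeS2 XE EXE) => om h1 h2.
  rewrite /end_cost /var_end -/X' -/X -/a h1 h2 !qfD// !dotvDr.
  by ring.
have YN om : Y N om = G_ L k *m X N om + Gb_ L k *m condEv k (X N) om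
    + (F_ L k *m xi om + g_ L k) by rewrite /Y subnn /= addrA.
have -> : (fun om => end_cost k xi (fb Phi v) om + 2 * dotv (Y N om) (a N om)
    + var_end k Phi ub om) = (fun om => end_cost k xi (fb Phi v) om +
    2 * (dotv (G_ L k *m X N om) (a N om)
      + dotv (Gb_ L k *m condEv k (X N) om) (a N om)
      + dotv (F_ L k *m xi om + g_ L k) (a N om)) + var_end k Phi ub om).
  by apply/funext => om; rewrite YN !dotvDl.
exact: ceq_refl.
Qed.

(** Discrete integration by parts: each transposed block in [Y l] moves to the variation, and the
    blocks reassemble into [a l.+1]. Time [k] is excluded because the control variation there is
    [ub] rather than the feedback response. *)
Let adjoint_step l : (k < l < N)%N ->
  ceq k (fun om => dotv (Y l om) (a l om))
        (fun om => lam l om + dotv (Y l.+1 om) (a l.+1 om)).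
Proof.
move=> /andP[kl lN].
have klN : (k <= l < N)%N by rewrite ltnW.
have klN' := ltW klN.
have kNk : (k <= k < N)%N by rewrite leqnn.
have llN : (l <= l < N)%N by rewrite leqnn.
have y2 : L2v (Y l.+1) by apply: Y2; rewrite lN ltnW// ltnW.
have X2l := X2 klN'; have EX2l := EX2 klN'; have a2l := a2 klN'.
have v2l := l2F_L2v (Fv klN); have Ev2l := l2F_L2v (l2F_condE kN v2l).
have Ea2l := Ea2 klN'.
pose lam' om := dotv (Q_ L k l *m X l om + Qb_ L k l *m condEv k (X l) om
    + q_ L k l) (a l om)
  + dotv (R_ L k l *m (Phi l *m X l om + v l om)
    + Rb_ L k l *m (Phi l *m condEv k (X l) om + condEv k (v l) om)
    + rho_ L k l) (Phi l *m a l om).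
have lamE : {ae P, forall om, lam l om = lam' om}.
  apply: filterS (condEv_fb klN) => om EU.
  by rewrite /lam /lam' EU /du gtn_eqF.
have lam'1 : L1 lam' by rewrite /lam'; L1_tac.
have Fal := Fa klN'; have FEal := l2F_condE kN a2l.
have c1 (M : 'M[R]_n) := ceq_pull_L2 klN y2 (l2FM M Fal).
(* A mean-field block moves in two steps: since [E_k Y] is F_k-measurable, [a l] may be replaced by
   [E_k (a l)]; this is then F_k-measurable in turn, so the expectation on Y may be dropped. [c4]
   repeats this with the noise. *)
have c2 (M : 'M[R]_n) : ceq k
    (fun om => dotv (condEv k (Y l.+1) om) (M *m a l om))
    (fun om => dotv (Y l.+1 om) (M *m condEv k (a l) om)).
  apply: ceq_trans (ceq_pull_mx M kN (l2F_condE kN y2) a2l) _.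
  exact: ceq_pull_L2 kNk y2 (l2FM M FEal).
have c3 i (M : 'M[R]_n) := ceq_pull_noise i (ltnW kl) llN y2 (l2FM M Fal).
have c4 i (M : 'M[R]_n) : ceq k
    (fun om => dotv (condEv k (fun om => w l i om *: Y l.+1 om) om)
                    (M *m a l om))
    (fun om => dotv (Y l.+1 om) (w l i om *: (M *m condEv k (a l) om))).
  apply: ceq_trans (ceq_pull_mx M kN (l2F_condE_noise i klN y2) a2l) _.
  have h := ceq_pull_noise i (leqnn k) klN y2 (l2FM M FEal).
  exact: h.
pose M1 := A_ L k l + B_ L k l *m Phi l.
pose M2 := Ab_ L k l + Bb_ L k l *m Phi l.
pose M3 i := C_ L k l i + D_ L k l i *m Phi l.
pose M4 i := Cb_ L k l i + Db_ L k l i *m Phi l.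
have c34 := ceq_sum sF (r := index_enum 'I_p)
  (fun i _ => ceqD sF (c3 i (M3 i)) (c4 i (M4 i))).
have lamc : ceq k lam' (lam l).
  apply: ceq_sym; apply: ceq_ae => //; first exact: lam1.
  exact: L1_measurable lam'1.
have := ceqD sF (ceqD sF (ceqD sF lamc (c1 M1)) (c2 M2)) c34.
congr (cond_eq _ _); apply/funext => om.
  rewrite [Y l]YrevS// -/(Y l.+1) adjoint_dyn dotv_suml -!dotv_mulmxr.
  congr (_ + _); apply: eq_bigr => i _.
  by rewrite dotvDl -!dotv_mulmxr.
rewrite [a l.+1]alphaS// -/a !dotvDr dotv_sumr.
under [in RHS]eq_bigr => i _ do rewrite scalerDr dotvDr.
by rewrite !addrA.
Qed.

(** At time [k] the state variation is 0, so only the control gradient of the running cost remains.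
    The two control weights merge because the control at time [k] is its own conditional
    expectation, and moving the [B] and [D] blocks back onto the adjoint gives [S]. *)
Let adjoint_first : ceq k (fun om => dotv (S om) (ub om))
  (fun om => lam k om + dotv (Y k.+1 om) (a k.+1 om)).
Proof.
have kNk : (k <= k < N)%N by rewrite leqnn.
have y2 : L2v (Y k.+1) by apply: Y2; rewrite kN leqnSn.
have U2k := U2 kNk; have ub2 := l2F_L2v Fub.
pose lam' om := dotv ((R_ L k k + Rb_ L k k) *m U k om + rho_ L k k) (ub om).
have lamE : {ae P, forall om, lam k om = lam' om}.
  apply: filterS (condEv_id kN (FU kNk)) => om EU.
  rewrite /lam /lam' EU /du eqxx /a alpha_start dotv0 add0r.
  by rewrite mulmxDl.
have lam'1 : L1 lam' by rewrite /lam'; L1_tac.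
have lamc : ceq k lam' (lam k).
  apply: ceq_sym; apply: ceq_ae => //; first exact: lam1.
  exact: L1_measurable lam'1.
have c1 := ceq_pull_L2 kNk y2 (l2FM (B_ L k k + Bb_ L k k) Fub).
have c2 := ceq_sum sF (r := index_enum 'I_p) (fun i _ =>
  ceq_pull_noise i (leqnn k) kNk y2 (l2FM (D_ L k k i + Db_ L k k i) Fub)).
have := ceqD sF (ceqD sF lamc c1) c2.
congr (cond_eq _ _); apply/funext => om.
  rewrite /S /stationarity -/X -/(Y k.+1) /lam' !dotvDl dotv_suml -/(U k om).
  under [in RHS]eq_bigr => i _ do rewrite dotv_mulmxl trmxK.
  rewrite [dotv (_^T *m _) _]dotv_mulmxl trmxK.
  by move: (\sum_(i < p) _) => s; ring.
by rewrite /a alpha_first dotvDr dotv_sumr addrA.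
Qed.

Let adjoint_telescope l : (k < l <= N)%N ->
  ceq k (fun om => dotv (S om) (ub om))
    (fun om => \sum_(k <= j < l) lam j om + dotv (Y l om) (a l om)).
Proof.
elim: l => [//|l IHl] /andP[kl lN].
move: kl; rewrite ltnS leq_eqVlt => /predU1P[<-|kl].
  by under [X in ceq k _ X]eq_fun do rewrite big_nat1; exact: adjoint_first.
have klN : (k <= l)%N := ltnW kl.
have IH := IHl (introT andP (conj kl (ltnW lN))).
apply: (ceq_trans IH).
have sum1 : L1 (fun om => \sum_(k <= j < l) lam j om).
  have [h _ _] : ceq k (fun om => \sum_(k <= j < l) lam j om)
      (fun om => \sum_(k <= j < l) lam j om).
    apply: ceq_sum_nat => // j /andP[kj jl]; apply: ceq_refl; apply: lam1.
    by rewrite kj (ltn_trans jl).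
  exact: h.
have kl' : (k < l < N)%N by rewrite kl.
have := ceqD sF (ceq_refl (Fgen k) sum1) (adjoint_step kl').
congr (cond_eq _ _); apply/funext => om.
by rewrite (big_nat_recr _ _ _ klN)/= addrA.
Qed.

(** At [l = k] the state terms vanish almost surely and the separate control term of [Jtilde]
    becomes [quad k]. At later times the closed-loop weights absorb the quadratic form of
    [Phi l *m a l]. *)
Let Jtilde_quad : ceq k (Jtilde N w E L k Phi ub)
  (fun om => \sum_(k <= l < N) quad l om + var_end k Phi ub om).
Proof.
apply: ceq_trans (Jtilde_ceq Phi kN Fub) _.
have kNN : (k <= N <= N)%N by rewrite leqnn ltnW.
have kNk : (k <= k < N)%N by rewrite leqnn.
have a2N := a2 kNN; have Ea2N := Ea2 kNN; have ub2 := l2F_L2v Fub.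
have var1 : L1 (var_end k Phi ub) by rewrite /var_end -/a; L1_tac.
have c1 : ceq k (fun om => var_run k Phi ub k om
    + qf (ub om) (R_ L k k + Rb_ L k k)) (quad k).
  apply: ceq_ae => //.
  - by apply: L1D; [exact: L1_var_run|exact: L1_qf].
  - exact: L1_measurable (quad1 kNk).
  - have Edu := condEv_du kNk; have E0 := condEv_id kN (@l2F_cst k n 0).
    apply: (aeS2 Edu E0) => om; rewrite eqxx => h1 h2.
    rewrite /quad /var_run h1 /a alpha_start h2 /du eqxx !qf0 qf_addM.
    by ring.
have c2 : ceq k (fun om => \sum_(k.+1 <= l < N) var_run k Phi ub l om)
    (fun om => \sum_(k.+1 <= l < N) quad l om).
  apply: ceq_sum_nat => // l /andP[kl lN].
  have klN : (k <= l < N)%N by rewrite ltnW.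
  apply: ceq_ae => //.
  - exact: L1_var_run.
  - exact: L1_measurable (quad1 klN).
  - apply: filterS (condEv_du klN) => om; rewrite gtn_eqF// => h.
    by rewrite /quad /var_run h /du gtn_eqF// !qf_mulmx !qf_addM -/a; ring.
have := ceqD sF (ceqD sF c1 c2) (ceq_refl (Fgen k) var1).
congr (cond_eq _ _); apply/funext => om; rewrite (big_ltn kN); ring.
Qed.

Lemma stationarity_l2F : l2F k (stationarity k Phi v xi).
Proof.
have kNk : (k <= k < N)%N by rewrite leqnn.
have y2 : L2v (Y k.+1) by apply: Y2; rewrite kN leqnSn.
have FXk : l2F k (X k) by exact: FX (ltW kNk).
have Fvk := Fv kNk; have FEy := l2F_condE kN y2.
apply: l2FD; last exact: l2F_cst.
apply: l2FD; first by l2F_tac.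
by apply: l2F_sum => i; apply: l2FM; exact: l2F_condE_noise.
Qed.

(** Both sides are F_k-measurable, so it suffices to compare them modulo [ceq k], where the running,
    terminal and telescoped parts simply add up. *)
Lemma cost_expansion : {ae P, forall om,
  Jcost N w E L k xi (mixpol k u Phi v) om =
  Jcost N w E L k xi (fb Phi v) om
  + 2 * dotv (stationarity k Phi v xi om) (u om - (Phi k *m xi om + v k om))
  + Jtilde N w E L k Phi (fun om => u om - (Phi k *m xi om + v k om)) om}.
Proof.
rewrite -/ub; apply: (Fmeas_ceq_ae_eq (ltnW kN)).
- by apply: Jcost_Fmeas => //; exact: adm_mixpol.
- apply: FmeasD; last exact: Jtilde_Fmeas.
  apply: FmeasD; first by apply: Jcost_Fmeas => //; exact: adm_fb.
  by apply: FmeasZ; apply: Fmeas_dotv => //; exact: stationarity_l2F.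
apply: ceq_trans (Jcost_ceq kN Fxi (adm_mixpol Phi Fv Fu)) _.
have c1 := ceqD sF (ceq_sum_nat sF run_split) end_split.
apply: ceq_trans c1 _; apply: ceq_sym.
have kNN : (k < N <= N)%N by rewrite kN leqnn.
have := ceqD sF (ceqD sF (Jcost_ceq kN Fxi (adm_fb Phi Fv))
  (ceqZ sF 2 (adjoint_telescope kNN))) Jtilde_quad.
congr (cond_eq _ _); apply/funext => om.
have sum3 (f g h : nat -> R) : \sum_(k <= l < N) (f l + 2 * g l + h l) =
    \sum_(k <= l < N) f l + 2 * (\sum_(k <= l < N) g l)
    + \sum_(k <= l < N) h l by rewrite !big_split/= -mulr_sumr.
by rewrite sum3; ring.
Qed.

End Perturbation.

(** * Equilibria *)

(** Homogeneity is only almost sure, because the recursion of [alpha] contains [E k]. *)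
Lemma alphaZ k Phi ub (c : R) l : (k < N)%N -> l2F k ub -> (k <= l <= N)%N ->
  {ae P, forall om,
    alpha k Phi (fun om => c *: ub om) l om = c *: alpha k Phi ub l om}.
Proof.
move=> kN Fub; elim: l => [|l IHl] klN.
  by apply: aeW => om; rewrite /= scaler0.
have /andP[kl lN] := klN; move: kl; rewrite leq_eqVlt => /predU1P[<-|].
  by apply: aeW => om; rewrite !alpha_start scaler0.
rewrite ltnS leq_eqVlt => /predU1P[<-|kl].
  apply: aeW => om; rewrite !alpha_first scalerDr scaler_sumr -scalemxAr.
  by congr (_ + _); apply: eq_bigr => i _; rewrite -scalemxAr !scalerA mulrC.
have klN' : (k <= l <= N)%N by rewrite (ltnW kl) (ltnW lN).
have {}IHl := IHl klN'.
have a2 := l2F_L2v (alpha_l2F Phi Fub klN').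
have ca2 := l2F_L2v (alpha_l2F Phi (l2FZ c Fub) klN').
have EcE : {ae P, forall om, condEv k (alpha k Phi (fun om => c *: ub om) l) om
    = c *: condEv k (alpha k Phi ub l) om}.
  have := @condEv_mulmx k _ _ c%:M _ _ kN ca2 a2; move=> /(_ _)/wrap[].
    by apply: filterS IHl => om ->; rewrite mul_scalar_mx.
  by apply: filterS => om ->; rewrite mul_scalar_mx.
apply: (aeS2 IHl EcE) => om h1 h2; rewrite !alphaS// h1 h2.
rewrite !scalerDr scaler_sumr -!scalemxAr; congr (_ + _).
by apply: eq_bigr => i _; rewrite -!scalemxAr -scalerDr !scalerA mulrC.
Qed.

Lemma JtildeZ k Phi ub (c : R) : (k < N)%N -> l2F k ub ->
  {ae P, forall om, Jtilde N w E L k Phi (fun om => c *: ub om) om =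
                    c ^+ 2 * Jtilde N w E L k Phi ub om}.
Proof.
move=> kN Fub; have Fcub := l2FZ c Fub; have sF := Filt_measurable (ltnW kN).
apply: (Fmeas_ceq_ae_eq (ltnW kN)); first exact: Jtilde_Fmeas.
  by apply: FmeasZ; exact: Jtilde_Fmeas.
have aZ l : (k <= l <= N)%N -> {ae P, forall om,
    alpha k Phi (fun om => c *: ub om) l om = c *: alpha k Phi ub l om /\
    condEv k (alpha k Phi (fun om => c *: ub om) l) om =
      c *: condEv k (alpha k Phi ub l) om}.
  move=> klN; have aE := alphaZ Phi c kN Fub klN.
  have a2 := l2F_L2v (alpha_l2F Phi Fub klN).
  have ca2 := l2F_L2v (alpha_l2F Phi Fcub klN).
  have := @condEv_mulmx k _ _ c%:M _ _ kN ca2 a2; move=> /(_ _)/wrap[].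
    by apply: filterS aE => om ->; rewrite mul_scalar_mx.
  move=> EaE; apply: (aeS2 aE EaE) => om -> ->.
  by rewrite mul_scalar_mx.
have kNN : (k <= N <= N)%N by rewrite leqnn ltnW.
have var1 : forall b, l2F k b -> L1 (var_end k Phi b).
  move=> b Fb; have b2 := l2F_L2v (alpha_l2F Phi Fb kNN).
  by apply: L1D; apply: L1_qf => //; exact: l2F_L2v (l2F_condE kN b2).
have c1 : ceq k
    (fun om => \sum_(k <= l < N) var_run k Phi (fun om => c *: ub om) l om)
    (fun om => \sum_(k <= l < N) c ^+ 2 * var_run k Phi ub l om).
  apply: ceq_sum_nat => // l klN; have klN' : (k <= l <= N)%N.
    by have /andP[-> /ltnW] := klN.
  apply: ceq_ae => //; first exact: L1_var_run.
    by apply: (@L1_measurable _ _ _ P); apply: L1Z; exact: L1_var_run.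
  apply: filterS (aZ l klN') => om [h1 h2].
  by rewrite /var_run h1 h2 !qfZ mulrDr.
have c2 : ceq k (var_end k Phi (fun om => c *: ub om))
    (fun om => c ^+ 2 * var_end k Phi ub om).
  apply: ceq_ae => //; first exact: var1.
    by apply: (@L1_measurable _ _ _ P); apply: L1Z; exact: var1.
  apply: filterS (aZ N kNN) => om [h1 h2].
  by rewrite /var_end h1 h2 !qfZ mulrDr.
have q1 := L1_qf (R_ L k k + Rb_ L k k) (l2F_L2v Fcub).
apply: ceq_trans (Jtilde_ceq Phi kN Fcub) _.
apply: ceq_trans (ceqD sF (ceqD sF c1 (ceq_refl (Fgen k) q1)) c2) _.
apply: ceq_sym; have := ceqZ sF (c ^+ 2) (Jtilde_ceq Phi kN Fub).
congr (cond_eq _ _); apply/funext => om.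
by rewrite -mulr_sumr qfZ; ring.
Qed.

Section Equilibrium.
Context (t : nat) (x : Omega -> 'cV[R]_n) (Phi : nat -> 'M[R]_(m, n))
  (v : nat -> Omega -> 'cV[R]_m).
Hypothesis Hsym : LQsym N L.
Hypothesis Fx : l2F t x.

Let S k := stationarity k Phi v (Xstar t x Phi v k).

Lemma stationarity_convexity_equilibrium :
  stationarity_convexity P N w E L t x Phi v ->
  mixed_equilibrium P N w E L t x Phi v.
Proof.
move=> [Fv SC]; split => // k tkN u Fu; have /andP[tk kN] := tkN.
have [S0 J0] := SC k tkN.
have Fv' l : (k <= l < N)%N -> l2F l (v l).
  by move=> /andP[kl lN]; apply: Fv; rewrite (leq_trans tk).
have Fxk : l2F k (Xstar t x Phi v k) by apply: Xstar_l2F; rewrite // tk ltnW.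
have Fub : l2F k (fun om => u om - (Phi k *m Xstar t x Phi v k om + v k om)).
  have Fvk : l2F k (v k) by exact: Fv.
  by apply: l2FB => //; l2F_tac.
have H := cost_expansion Phi kN Fxk Fv' Fu Hsym.
have H' := aeS2 S0 (J0 _ Fub) (fun _ h1 h2 => conj h1 h2).
apply: (aeS2 H H') => om -> [S0om J0om].
rewrite -[stationarity _ _ _ _ _]/(S k om).
have -> : S k om = 0 by rewrite S0om.
by rewrite dotvC dotv0 mulr0 addr0 lerDl.
Qed.

Lemma equilibrium_stationarity_convexity :
  mixed_equilibrium P N w E L t x Phi v ->
  stationarity_convexity P N w E L t x Phi v.
Proof.
move=> [Fv ME]; split => // k tkN; have /andP[tk kN] := tkN.
have Fv' l : (k <= l < N)%N -> l2F l (v l).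
  by move=> /andP[kl lN]; apply: Fv; rewrite (leq_trans tk).
have Fxk : l2F k (Xstar t x Phi v k) by apply: Xstar_l2F; rewrite // tk ltnW.
have Fvk : l2F k (v k) by exact: Fv.
have key ub : l2F k ub -> {ae P, forall om,
    0 <= 2 * dotv (S k om) (ub om) + Jtilde N w E L k Phi ub om}.
  move=> Fub.
  pose u om := (Phi k *m Xstar t x Phi v k om + v k om) + ub om.
  have Fu : l2F k u by rewrite /u; l2F_tac.
  have ubE om : u om - (Phi k *m Xstar t x Phi v k om + v k om) = ub om.
    by rewrite /u addrC addKr.
  have H := cost_expansion Phi kN Fxk Fv' Fu Hsym.
  apply: (aeS2 H (ME k tkN u Fu)) => om ->.
  by rewrite (funext ubE) ubE -addrA lerDl.
have FSk : l2F k (S k) := stationarity_l2F Phi kN Fxk Fv'.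
have S0 : {ae P, forall om, 0 = S k om}.
  have Hj : {ae P, forall om, forall j,
      2 * dotv (S k om) (S k om)
      <= j.+1%:R^-1 * Jtilde N w E L k Phi (S k) om}.
    (* perturb the equilibrium control by [- S / (j + 1)] *)
    apply: ae_foralln => j; pose c : R := - j.+1%:R^-1.
    apply: (aeS2 (key _ (l2FZ c FSk)) (JtildeZ Phi c kN FSk)) => om + JE.
    rewrite JE dotvZr /c sqrrN expr2 -mulrA.
    move: (dotv _ _) (Jtilde _ _ _ _ _ _ _ _) => y z.
    have : 0 < j.+1%:R^-1 :> R by rewrite invr_gt0.
    move: (j.+1%:R^-1) => e e0.
    rewrite mulNr mulrN addrC subr_ge0 mulrCA ler_pM2l//.
  apply: filterS Hj => om Hj; apply/esym/dotv_eq0/eqP.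
  rewrite eq_le dotv_ge0 andbT leNgt; apply/negP => SS0.
  move: (Jtilde _ _ _ _ _ _ _ _) Hj => z Hj.
  move: (dotv _ _) SS0 Hj => y y0 Hj.
  (* Archimedean choice: [z / j.+1 < y], which contradicts [2 * y <= z / j.+1] for [y > 0]. *)
  pose j := Num.Def.truncn (z / y).
  have jz : z < j.+1%:R * y by rewrite -ltr_pdivrMr//; exact: truncnS_gt.
  have jy : 0 < j.+1%:R * y by rewrite mulr_gt0.
  by have := Hj j; rewrite ler_pdivlMl// mulrCA; lra.
split; first exact: S0.
move=> ub Fub; apply: (aeS2 S0 (key ub Fub)) => om <-.
by rewrite dotvC dotv0 mulr0 add0r.
Qed.

End Equilibrium.

End Filtration.

Theorem mainTheorem2
  (R : realType) (dsp : measure_display) (Omega : measurableType dsp)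
  (P : probability Omega R) (N n m p : nat)
  (w : nat -> 'I_p -> Omega -> R)
  (Delta : nat -> 'M[R]_p)
  (E : nat -> (Omega -> R) -> Omega -> R)
  (L : LQdata R n m p)
  (HN : (0 < N)%N) (Hn : (0 < n)%N) (Hm : (0 < m)%N) (Hp : (0 < p)%N)
  (* noise: square integrable, E_k[w_k] = 0, E_k[w_k w_k^T] = Delta_k *)
  (Hw_meas : forall k (i : 'I_p), (k < N)%N -> measurable_fun setT (w k i))
  (Hw_sq : forall k (i : 'I_p), (k < N)%N ->
            P.-integrable setT (fun om => ((w k i om) ^+ 2)%:E))
  (* E k is a version of the conditional expectation E[ . | F_k] *)
  (HE : forall k, (k < N)%N -> forall X : Omega -> R,
          P.-integrable setT (EFin \o X) -> is_cond_exp P w k X (E k X))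
  (Hw_mean : forall k (i : 'I_p), (k < N)%N -> {ae P, forall om, E k (w k i) om = 0})
  (Hw_cov : forall k (i j : 'I_p), (k < N)%N ->
            {ae P, forall om, E k (fun om' => w k i om' * w k j om') om = Delta k i j})
  (Hsym : LQsym N L)
  (t : nat) (x : Omega -> 'cV[R]_n)
  (Ht : (t < N)%N) (Hx : l2F P w t x) :
  ((exists (Phi : nat -> 'M[R]_(m, n)) (v : nat -> Omega -> 'cV[R]_m),
      mixed_equilibrium P N w E L t x Phi v)
   <->
   (exists (Phi : nat -> 'M[R]_(m, n)) (v : nat -> Omega -> 'cV[R]_m),
      stationarity_convexity P N w E L t x Phi v))
  /\
  (forall (Phi : nat -> 'M[R]_(m, n)) (v : nat -> Omega -> 'cV[R]_m),
      stationarity_convexity P N w E L t x Phi v ->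
      mixed_equilibrium P N w E L t x Phi v).
Proof.
(* The equivalence holds for each pair separately, which gives both the existence statement and the
   final claim. *)
have equiv Phi v : mixed_equilibrium P N w E L t x Phi v <->
    stationarity_convexity P N w E L t x Phi v.
  split.
    exact: (equilibrium_stationarity_convexity Hw_meas Hw_sq HE Hw_cov Hsym Hx).
  exact: (stationarity_convexity_equilibrium Hw_meas Hw_sq HE Hw_cov Hsym Hx).
split; last by move=> Phi v /equiv.
by split=> -[Phi [v /equiv H]]; exists Phi, v.
Qed.
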